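(* There exists $n_0$ such that for every $n\ge n_0$ the following holds. Let $t=\frac{1}{10}n^{1/4}$ (rounded to an integer). If $T_1,T_2,\dots,T_t$ are trees such that $|T_i| = n-i+1$ for every $i$, then $T_1,T_2,\dots,T_t$ pack into the complete graph $K_{n+1}$.
   Context: $|T|$ denotes the number of vertices of $T$. A set of graphs $G_1,\dots,G_m$ packs into a graph $H$ if $G_1,\dots,G_m$ can be found as pairwise edge-disjoint subgraphs of $H$. The paper suppresses integer-part notation, so quantities such as $\frac1{10} n^{1/4}$ are understood as integers. *)

(* Defs.v *)
From mathcomp Require Import all_boot.
Set Implicit Arguments. Unset Strict Implicit. Unset Printing Implicit Defensive.

Definition simple_graph (V : finType) (e : rel V) : Prop :=
  symmetric e /\ irreflexive e.

Definition connected_graph (V : finType) (e : rel V) : Prop :=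
  forall x y : V, connect e x y.

Definition acyclic_graph (V : finType) (e : rel V) : Prop :=
  forall s : seq V, uniq s -> 3 <= size s -> ~~ cycle e s.

Definition is_tree (V : finType) (e : rel V) : Prop :=
  [/\ simple_graph e, 0 < #|V|, connected_graph e & acyclic_graph e].

(* The graphs G_i (i : I) pack into the complete graph K_N (vertex set 'I_N):
   there are injective vertex maps f_i : V_i -> 'I_N (so each G_i is a subgraph
   of K_N) whose edge images are pairwise disjoint for distinct indices. *)
Definition packs_into_complete (N : nat) (I : finType) (V : I -> finType)
    (G : forall i : I, rel (V i)) : Prop :=
  exists f : forall i : I, V i -> 'I_N,
    (forall i, injective (f i)) /\
    (forall (i j : I) (x y : V i) (u v : V j), i != j ->
       G i x y -> G j u v ->
       ~ ((f i x = f j u /\ f i y = f j v) \/ (f i x = f j v /\ f i y = f j u))).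

(* t(n) = floor (n^{1/4} / 10): the largest k with (10 k)^4 <= n. *)
Definition tnum (n : nat) : nat := \max_(k < n.+1 | (10 * k) ^ 4 <= n) k.

(* Main.v *)
(** Number the trees from 0, so that tree [i] has [n - i] vertices. A tree with a vertex of degree at least about
    4n/5 is star-like; its centre gets a host [c i] of its own, avoided by all later trees. A star-like tree [i] leaves
    [i + 1] of the [n + 1] hosts unused, and the earlier trees may only use edges from [c i] to such hosts. The earlier
    star-like trees account for one of them each, so every earlier tree that is not star-like may use about one edge at
    [c i], with a single edge to spare. A tree with at least [t] leaves visits [c i] with a leaf. A tree with fewer
    leaves is path-like: it contains a long path of vertices of degree 2 and visits the centres with pieces of this
    path, called chains. Going from one centre to the next costs one edge, opening a new chain costs two. Different trees must step to [c i]
    from different centres, which needs many open chains; the extra openings are paid for by trees that skip [c i].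

    The trees are embedded one after the other into the unused edges. Vertices of degree at least 40 go to hosts of
    small degree, small vertices are chosen greedily for the few dangerous hosts, and the remaining vertices are
    placed by minimising the number of conflicts, where a conflict is removed by swapping two vertices as in the
    Sauer-Spencer theorem. The real obstruction is a host joined by used edges to the hosts of almost all big vertices
    of the tree. It is excluded by reserving blocks [Ba i] and [Bb i] for tree [i] in advance, such that no host is
    ever joined to both, and by putting two groups of big vertices of tree [i] on these blocks. *)

Require Import Defs.
From mathcomp Require Import all_boot zify.
Set Implicit Arguments. Unset Strict Implicit. Unset Printing Implicit Defensive.

(** Away from the star centres there is linear slack. The reserved hosts number O(t^2) and meet O(t)
    used edges each, and a bare path of length t (t + 2) exists once a tree with at most t leaves
    has somewhat more than 4 t^3 vertices. All demands are thus cubic in t, far below n. At the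
    centres the counting is exact. Hence there are two separate accounts: the used edges outside the
    centres form a graph [H] with degree invariants, while edges at a centre are never recorded, and
    their disjointness follows from the combinatorial scheme alone.

    The threshold 4n/5 serves both sides. Below it, no host outside the centres meets much more than
    4n/5 used edges, which leaves room for swapping and for splitting the big vertices into two
    groups. Above it, about 3n/5 neighbours of the centre are leaves; their only tree edge ends at
    the centre, so they fit on every dangerous host. *)

Definition nbr (T : finType) (e : rel T) (x : T) : {set T} := [set y | e x y].
Definition deg (T : finType) (e : rel T) (x : T) : nat := #|nbr e x|.

Lemma in_nbr (T : finType) (e : rel T) x y : (y \in nbr e x) = e x y.
Proof. by rewrite inE. Qed.

Lemma card_bigcup_leq (I T : finType) (P : pred I) (F : I -> {set T}) :
  #|\bigcup_(i | P i) F i| <= \sum_(i | P i) #|F i|.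
Proof.
apply: (big_ind2 (fun (A : {set T}) k => #|A| <= k)) => //; first by rewrite cards0.
by move=> A a B b ? ?; apply: leq_trans (leq_card_setU _ _) _; apply: leq_add.
Qed.

Lemma exists_notin (T : finType) (A B : {set T}) : #|B| < #|A| -> exists2 x, x \in A & x \notin B.
Proof.
move=> lt; case: (set_0Vmem (A :\: B)) => [E|[x]]; last by rewrite inE => /andP[]; exists x.
have /subset_leq_card : A \subset B by rewrite -setD_eq0 E.
by rewrite leqNgt lt.
Qed.

Lemma exists_injection (T V : finType) (v0 : V) (X : {set T}) (U : {set V}) :
  #|X| <= #|U| -> exists f : T -> V, {in X &, injective f} /\ {in X, forall x, f x \in U}.
Proof.
move=> le; exists (fun x => nth v0 (enum U) (index x (enum X))).
have lt x : x \in X -> index x (enum X) < size (enum U).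
  by move=> xX; rewrite -cardE; apply: leq_trans le; rewrite cardE index_mem mem_enum.
split=> [x y xX yX /eqP|x xX]; last by rewrite -mem_enum mem_nth ?lt.
by rewrite nth_uniq ?lt ?enum_uniq // => /eqP /index_inj -> //; rewrite mem_enum.
Qed.

(** * Swapping *)

Section Swap.

Variables (T V : finType) (e : rel T) (K : rel V) (X : {set T}) (g : T -> V) (U : {set V}).
Hypotheses (e_sym : symmetric e) (K_sym : symmetric K) (e_irr : irreflexive e).

Definition extends_into (f : T -> V) : Prop :=
  [/\ injective f, {in X, f =1 g} & forall x, x \notin X -> f x \in U].

Let conflicts (f : T -> V) : {set T * T} := [set p | e p.1 p.2 && K (f p.1) (f p.2)].

Hypotheses (g_inj : {in X &, injective g}) (g_out : {in X, forall x, g x \notin U}).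
Hypothesis card_U : #|~: X| <= #|U|.
Hypothesis g_free : {in X &, forall x y, e x y -> ~~ K (g x) (g y)}.
Hypothesis room : forall f x, extends_into f -> x \notin X ->
  \sum_(w | e x w) deg K (f w) + \sum_(w | K (f x) (f w)) deg e w + deg e x + 1 < #|U|.

Lemma extends_into_exists (v0 : V) : exists f, extends_into f.
Proof.
have [h [h_inj hU]] := exists_injection v0 card_U.
exists (fun x => if x \in X then g x else h x); split.
- move=> x y; case: ifP => xX; case: ifP => yX; first exact: g_inj.
  + by move=> E; have := g_out xX; rewrite E hU // inE yX.
  + by move=> E; have := g_out yX; rewrite -E hU // inE xX.
  + by apply: h_inj; rewrite inE ?xX ?yX.
- by move=> x ->.
- by move=> x xX; rewrite (negPf xX) hU // inE.
Qed.

(** The vertex [x] moves to a host [h], and the vertex on [h], if any, moves to [f x]. Of the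
    excluded sets, [E1] keeps [x] free of conflicts on [h], [E2] does the same for the displaced
    vertex on [f x], and [E3] ensures that the two are not adjacent. Their sizes are bounded by the
    terms of [room]. *)
Lemma swap_step f x y : extends_into f -> x \notin X -> e x y -> K (f x) (f y) ->
  exists2 f', extends_into f' & #|conflicts f'| < #|conflicts f|.
Proof.
move=> vf xX exy Kxy; have [f_inj fg fU] := vf.
pose E1 := \bigcup_(w | e x w) nbr K (f w).
pose E2 := f @: \bigcup_(w | K (f x) (f w)) nbr e w.
pose E3 := f @: nbr e x.
have [h hU hE] : exists2 h, h \in U & h \notin (E1 :|: E2 :|: E3) :|: [set f x].
  apply: exists_notin; apply: leq_ltn_trans (room vf xX).
  apply: leq_trans (leq_card_setU _ _) _; rewrite cards1 leq_add2r.
  apply: leq_trans (leq_card_setU _ _) _; apply: leq_add; last exact: leq_imset_card.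
  apply: leq_trans (leq_card_setU _ _) _; apply: leq_add; first exact: card_bigcup_leq.
  by apply: leq_trans (leq_imset_card _ _) _; apply: card_bigcup_leq.
move: hE; rewrite !inE !negb_or => /andP[/andP[/andP[h1 h2] h3] h4].
have H1 w : e x w -> ~~ K h (f w).
  move=> exw; apply: contra h1 => ?; apply/bigcupP; exists w => //.
  by rewrite in_nbr K_sym.
have H2 z w : f z = h -> e z w -> ~~ K (f x) (f w).
  move=> fz ezw; apply: contra h2 => Kw; rewrite -fz; apply: imset_f.
  by apply/bigcupP; exists w => //; rewrite in_nbr e_sym.
have H3 z : f z = h -> ~~ e x z.
  by move=> fz; apply: contra h3 => exz; rewrite -fz; apply: imset_f; rewrite in_nbr.
pose f' z := if z == x then h else if f z == h then f x else f z.
have f'x : f' x = h by rewrite /f' eqxx.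
have f'nbr w : e x w -> f' w = f w.
  move=> exw; rewrite /f'; case: eqP => [E|_]; first by rewrite E e_irr in exw.
  by case: eqP => // fw; rewrite (negPf (H3 _ fw)) in exw.
have f'o w : w != x -> f w != h -> f' w = f w.
  by rewrite /f' => /negPf-> /negPf->.
have f'z z : f z = h -> f' z = f x.
  rewrite /f' => fz; case: eqP => [E|_]; first by rewrite -fz E eqxx in h4.
  by rewrite fz eqxx.
exists f'.
  split.
  - move=> a b; rewrite /f'; case: (eqVneq a x) => [->|ax]; case: (eqVneq b x) => [->//|bx].
    + by case: eqVneq => [fb E|fb E]; [rewrite E eqxx in h4 | rewrite -E eqxx in fb].
    + by case: eqVneq => [fb E|fb E]; [rewrite E eqxx in h4 | rewrite E eqxx in fb].
    + case: eqVneq => [fa|fa]; case: eqVneq => [fb|fb].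
      * by move=> _; apply: f_inj; rewrite fa fb.
      * by move/f_inj=> E; rewrite E eqxx in bx.
      * by move/f_inj=> E; rewrite E eqxx in ax.
      * exact: f_inj.
  - move=> a aX; rewrite f'o ?fg //; first by apply: contraNneq xX => <-.
    by apply: contraNneq (g_out aX) => ->.
  - move=> a aX; rewrite /f'; case: eqP => // _; case: eqP => // _; exact: fU.
apply: proper_card; apply/properP; split.
  apply/subsetP => -[a b]; rewrite !inE /= => /andP[eab]; rewrite eab /=.
  have [E|ax] := eqVneq a x.
    by move: eab; rewrite E => exb; rewrite f'x f'nbr // (negPf (H1 _ exb)).
  have [E|bx] := eqVneq b x.
    move: eab; rewrite E e_sym => exa; rewrite f'x f'nbr // K_sym (negPf (H1 _ exa)) //.
  have [fa|fa] := eqVneq (f a) h.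
    rewrite f'z // f'o // ?(negPf (H2 _ _ fa eab)) //.
    by apply: contraTneq eab => fb; rewrite (f_inj _ _ (etrans fa (esym fb))) e_irr.
  have [fb|fb] := eqVneq (f b) h; last by rewrite !f'o.
  by rewrite (f'z b) // f'o // K_sym; move: eab; rewrite e_sym => eba; rewrite (negPf (H2 _ _ fb eba)).
exists (x, y); rewrite !inE /= ?exy ?Kxy // f'x f'nbr // (negPf (H1 _ exy)) //.
Qed.

Lemma swap_embedding (v0 : V) :
  exists2 f, extends_into f & forall x y, e x y -> ~~ K (f x) (f y).
Proof.
have [f vf] := extends_into_exists v0.
move: {2}(#|conflicts f|) (leqnn #|conflicts f|) => k; elim: k f vf => [|k IH] f vf.
  rewrite leqn0 cards_eq0 => /eqP C0; exists f => // x y exy; apply/negP => Kxy.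
  by have := in_set0 (x, y); rewrite -C0 inE /= exy Kxy.
move=> le; case: (set_0Vmem (conflicts f)) => [E|[[x y]]].
  by apply: (IH f vf); rewrite E cards0.
rewrite inE /= => /andP[exy Kxy].
(* By [g_free] a conflict has an end outside [X], and that end can be moved. *)
have [xX|xX] := boolP (x \in X); last first.
  by have [f' vf' lt] := swap_step vf xX exy Kxy; apply: (IH f' vf'); rewrite -ltnS (leq_trans lt).
have [yX|yX] := boolP (y \in X); last first.
  rewrite e_sym in exy; rewrite K_sym in Kxy.
  by have [f' vf' lt] := swap_step vf yX exy Kxy; apply: (IH f' vf'); rewrite -ltnS (leq_trans lt).
have [_ fg _] := vf.
by have := g_free xX yX exy; rewrite -!fg // Kxy.
Qed.

End Swap.

(** * Trees and forests *)

(** Acyclicity as a peeling property, inherited by every vertex subset and therefore suited to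
    induction. *)
Definition degenerate (T : finType) (e : rel T) : Prop :=
  forall S : {set T}, S != set0 -> exists2 x, x \in S & #|nbr e x :&: S| <= 1.

(** If every vertex of [S] had two neighbours in [S], a path in [S] could be prolonged forever: a
    neighbour of its end other than the adjacent path vertex is new, since otherwise it would close
    a cycle. *)
Lemma acyclic_degenerate (T : finType) (e : rel T) :
  simple_graph e -> acyclic_graph e -> degenerate e.
Proof.
move=> [e_sym e_irr] acyc S /set0Pn[x0 x0S].
have [/exists_inP[x xS xle]|] := boolP [exists x in S, #|nbr e x :&: S| <= 1]; first by exists x.
move/exists_inPn=> many; exfalso.
suff long k : exists x p, [/\ x \in S, path e x p, uniq (x :: p) & size p = k].
  have [x [p [_ _ /card_uniqP E sz]]] := long #|T|.
  by have := max_card [in x :: p]; rewrite E /= sz ltnn.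
elim: k => [|k [x [p [xS xp up sz]]]]; first by exists x0, [::].
have /many : x \in S by [].
rewrite -ltnNge => gt1.
(* For empty [p] the default [x] is harmless, since [x] is not its own neighbour. *)
have [z zA znE] : exists2 z, z \in nbr e x :&: S & z \notin [set head x p].
  by apply: exists_notin; rewrite cards1.
move: zA; rewrite !inE in znE * => /andP[exz zS].
have zx : z != x by apply: contraTneq exz => ->; rewrite e_irr.
have [zp|zp] := boolP (z \in p); last first.
  exists z, (x :: p); split => //=; last by rewrite sz.
    by rewrite e_sym exz xp.
  by rewrite inE negb_or zx zp.
case: p xp up sz znE zp => // y p /= /andP[exy yp] up _ zy.
rewrite inE (negPf zy) /= => zp.
case/splitPr: zp yp up => p1 p2; rewrite cat_path /= => /and3P[yp1 lz _] up.
have := acyc [:: x, y & rcons p1 z].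
have -> : uniq [:: x, y & rcons p1 z].
  move: up; rewrite -cat_rcons !cons_uniq !inE !mem_cat !negb_or cat_uniq.
  by case/andP=> /and3P[-> -> _] /andP[/andP[-> _] /andP[-> _]].
rewrite /= size_rcons !rcons_path exy last_rcons yp1 lz e_sym exz.
by move=> /(_ isT isT).
Qed.

Lemma sum_setU (T : finType) (A B : {set T}) (F : T -> nat) : [disjoint A & B] ->
  \sum_(x in A :|: B) F x = \sum_(x in A) F x + \sum_(x in B) F x.
Proof. by move=> dAB; rewrite -bigU //; apply: eq_bigl => x; rewrite !inE. Qed.

Section Degenerate.

Variables (T : finType) (e : rel T).
Hypotheses (e_sym : symmetric e) (e_irr : irreflexive e) (dgn : degenerate e).

Lemma sum_deg_within (S : {set T}) : \sum_(x in S) #|nbr e x :&: S| <= (#|S|.-1).*2.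
Proof.
move: {2}#|S| (leqnn #|S|) => k; elim: k S => [|k IH] S.
  by rewrite leqn0 cards_eq0 => /eqP->; rewrite big_set0.
move=> le; have [->|S0] := eqVneq S set0; first by rewrite big_set0.
have [x xS x1] := dgn S0.
have := cardsD1 x S; rewrite xS => cS.
have := IH (S :\ x); rewrite (big_setD1 x xS) /=.
have -> : \sum_(y in S :\ x) #|nbr e y :&: S| =
  \sum_(y in S :\ x) #|nbr e y :&: (S :\ x)| + #|nbr e x :&: S|.
  have -> : #|nbr e x :&: S| = \sum_(y in S :\ x) e y x.
    rewrite -sum1_card big_mkcond [RHS]big_mkcond /=; apply: eq_bigr => y _.
    rewrite !inE e_sym; have [->|/=] := eqVneq y x; first by rewrite e_irr.
    by case: (y \in S); rewrite ?andbT ?andbF //; case: (e y x).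
  rewrite -big_split /=; apply: eq_bigr => y /setD1P[yx yS].
  rewrite (cardsD1 x (nbr e y :&: S)) !inE xS andbT addnC; congr (_ + _).
  by apply: eq_card => z; rewrite !inE andbCA.
have [S1|S1] := eqVneq (S :\ x) set0.
  move=> _; rewrite S1 big_set0.
  have : #|nbr e x :&: S| = 0.
    apply: eq_card0 => z; rewrite !inE; have := in_set0 z; rewrite -S1 !inE.
    by case: eqVneq => [->|zx] /=; [rewrite e_irr | move->; rewrite andbF].
  by move->.
move/(_ _); have := S1; rewrite -card_gt0 => gt0; lia.
Qed.

Lemma sum_deg : \sum_x deg e x <= (#|T|.-1).*2.
Proof.
have := sum_deg_within [set: T]; rewrite cardsT; apply: leq_trans.
have -> : \sum_x deg e x = \sum_(x in [set: T]) deg e x by apply: eq_bigl => x; rewrite inE.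
by apply: leq_sum => x _; rewrite setIT.
Qed.

Lemma card_deg_ge (D : nat) (B : {set T}) : {in B, forall x, D <= deg e x} -> #|B| * D <= #|T|.*2.
Proof.
move=> BD; apply: (@leq_trans (\sum_(x in B) deg e x)).
  by rewrite -sum_nat_const; apply: leq_sum.
apply: leq_trans (_ : \sum_x deg e x <= _); last by apply: leq_trans sum_deg _; rewrite leq_double leq_pred.
by rewrite [X in _ <= X](bigID [in B]) /= leq_addr.
Qed.

(* The bipartite graph between [A] and [B] is a forest with at least [2 #|A|] edges. *)
Lemma card_two_nbrs (A B : {set T}) :
  [disjoint A & B] -> {in A, forall x, 1 < #|nbr e x :&: B|} -> #|A| <= #|B|.
Proof.
move=> dAB A2; have := sum_deg_within (A :|: B).
have dc : \sum_(x in A) #|nbr e x :&: B| = \sum_(y in B) #|nbr e y :&: A|.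
  transitivity (\sum_(x in A) \sum_(y in B) e x y).
    apply: eq_bigr => x _; rewrite -sum1_card big_mkcond [RHS]big_mkcond /=.
    by apply: eq_bigr => y _; rewrite !inE; case: (y \in B); case: (e x y).
  rewrite exchange_big; apply: eq_bigr => y _; rewrite -sum1_card big_mkcond [RHS]big_mkcond /=.
  by apply: eq_bigr => x _; rewrite !inE e_sym; case: (x \in A); case: (e y x).
have : #|A|.*2 <= \sum_(x in A) #|nbr e x :&: B|.
  by rewrite -muln2 -sum_nat_const; apply: leq_sum => x /A2.
rewrite sum_setU //= => h1 h2.
have le1 : \sum_(x in A) #|nbr e x :&: B| <= \sum_(x in A) #|nbr e x :&: (A :|: B)|.
  by apply: leq_sum => x _; apply/subset_leq_card/setIS/subsetUr.
have le2 : \sum_(x in B) #|nbr e x :&: A| <= \sum_(x in B) #|nbr e x :&: (A :|: B)|.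
  by apply: leq_sum => x _; apply/subset_leq_card/setIS/subsetUl.
have := cardsU A B; have -> : A :&: B = set0 by apply/eqP; rewrite setI_eq0.
rewrite cards0; lia.
Qed.

Hypothesis deg_gt0 : forall x, 0 < deg e x.

(** In the degree sum, which is at most [2 (#|T| - 1)], the vertex [v] counts [deg e v], every other
    vertex at least 1, and every neighbour of [v] that is no leaf at least one more. *)
Lemma card_leaf_nbrs v : (deg e v).*2 <= #|T| + #|[set x in nbr e v | deg e x == 1]|.
Proof.
set Lf := [set x in _ | _].
have h : deg e v + (#|T|.-1 + #|nbr e v :\: Lf|) <= \sum_x deg e x.
  rewrite (bigD1 v) //= leq_add2l.
  have -> : #|T|.-1 = \sum_(x | x != v) 1 by rewrite sum1_card cardC1.
  have -> : #|nbr e v :\: Lf| = \sum_(x | x != v) (x \in nbr e v :\: Lf).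
    rewrite -sum1_card big_mkcond [RHS]big_mkcond; apply: eq_bigr => x _.
    by have [->|] := eqVneq x v; [rewrite !inE e_irr andbF | case: (x \in _)].
  rewrite -big_split; apply: leq_sum => x _ /=.
  by rewrite !inE; have := deg_gt0 x; case: (e v x); case: (deg e x) => [|[|]].
have := cardsID Lf (nbr e v).
have -> : nbr e v :&: Lf = Lf by apply/setIidPr/subsetP => x; rewrite inE => /andP[].
have := sum_deg; have : 0 < #|T| by apply/card_gt0P; exists v.
rewrite /deg in h *; lia.
Qed.

Lemma deg_pair_le x y : x != y -> deg e y + deg e x <= #|T|.
Proof.
move=> xy; have : #|[set y; x]| + #|~: [set y; x]| = #|T| := cardsC _.
have : deg e y + (deg e x + #|~: [set y; x]|) <= \sum_z deg e z.
  rewrite (bigD1 y) //= (bigD1 x) //= !leq_add2l -sum1_card.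
  rewrite (eq_bigl (fun z => (z != y) && (z != x))) => [|z]; last by rewrite !inE negb_or.
  by apply: leq_sum => z _; apply: deg_gt0.
have := sum_deg; have : 0 < #|T| by apply/card_gt0P; exists x.
by rewrite cards2 eq_sym xy; lia.
Qed.

Let S := [set x | deg e x != 2].

(** The average degree is at most 2, so the vertices of degree at least 3 must be balanced by
    leaves: each leaf lacks one, each of the former has at least one in excess. *)
Lemma sum_deg_branch (l : nat) : #|[set x | deg e x == 1]| <= l ->
  \sum_(x in S) deg e x <= 4 * l /\ #|S| <= 2 * l.
Proof.
set S1 := [set x | _] => le.
pose S3 := [set x | 2 < deg e x].
have SE : S = S1 :|: S3.
  by apply/setP => x; rewrite !inE; have := deg_gt0 x; case: (deg e x) => [|[|[|]]].
have d13 : [disjoint S1 & S3].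
  by rewrite disjoints_subset; apply/subsetP => x; rewrite !inE => /eqP->.
have s1 : \sum_(x in S1) deg e x = #|S1|.
  by rewrite -sum1_card; apply: eq_bigr => x; rewrite inE => /eqP.
have s3 : 3 * #|S3| <= \sum_(x in S3) deg e x.
  by rewrite mulnC -sum_nat_const; apply: leq_sum => x; rewrite inE.
have tot : \sum_x deg e x = \sum_(x in S) deg e x + (#|~: S|).*2.
  rewrite (bigID [in S]) /=; congr (_ + _).
  rewrite -muln2 -sum_nat_const; apply: eq_big => [x|x]; rewrite !inE ?negbK //.
  by move/eqP.
have cS : #|S| = #|S1| + #|S3|.
  by rewrite SE cardsU (_ : S1 :&: S3 = set0) ?cards0 ?subn0 //; apply/eqP; rewrite setI_eq0.
have sS : \sum_(x in S) deg e x = #|S1| + \sum_(x in S3) deg e x.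
  by rewrite SE sum_setU // s1.
have := sum_deg; have := cardsC S; rewrite tot; lia.
Qed.

Hypothesis conn : connected_graph e.

Lemma path_to_branch v : 0 < #|S| -> exists p,
  [/\ path e v p, last v p \in S, uniq (v :: p) & all (predC [in S]) (belast v p)].
Proof.
case/card_gt0P=> s sS.
have /connectP[p0 vp0 sE] := conn v s.
have lS0 : last v p0 \in S by rewrite -sE.
case/shortenP: vp0 lS0 => p vp up _ lS {p0 sE}.
suff [q [r [E vq lq aq]]] : exists q r,
   [/\ p = q ++ r, path e v q, last v q \in S & all (predC [in S]) (belast v q)].
  exists q; split => //; move: up; rewrite E -cat_cons cat_uniq.
  by case/andP.
elim: p v vp lS {up} => [|w p IH] v /=; first by move=> _ vS; exists [::], [::].
case/andP=> evw wp lS; have [vS|vS] := boolP (v \in S).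
  by exists [::], (w :: p).
have [q [r [-> wq lq aq]]] := IH w wp lS.
by exists (w :: q), r; split => //=; [rewrite evw | rewrite vS].
Qed.

End Degenerate.

Lemma tree_degenerate (T : finType) (e : rel T) : is_tree e -> degenerate e.
Proof. by case=> sg _ _; apply: acyclic_degenerate. Qed.

Lemma tree_deg_gt0 (T : finType) (e : rel T) : is_tree e -> 1 < #|T| -> forall x, 0 < deg e x.
Proof.
move=> [_ _ conn _] T1 x.
have [|y _] := @exists_notin _ [set: T] [set x]; first by rewrite cards1 cardsT.
rewrite inE => yx; have /connectP[[|z p] /=] := conn x y; first by move=> _ E; rewrite E eqxx in yx.
by case/andP=> exz _ _; apply/card_gt0P; exists z; rewrite inE.
Qed.

(** * Long paths of vertices of degree 2 *)

Section BarePath.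

Variables (T : finType) (e : rel T).
Hypotheses (e_sym : symmetric e) (conn : connected_graph e).

Let S := [set x | deg e x != 2].
Let other (a b : T) : T := odflt b [pick z in nbr e b :\ a].
Let step (ab : T * T) : T * T := (ab.2, other ab.1 ab.2).

Lemma other_nbr a b c : deg e b = 2 -> e b a -> e b c -> a != c -> other a b = c.
Proof.
move=> b2 eba ebc ac; have /eqP/cards2P[u [w [uw E]]] : #|nbr e b| = 2 by [].
have aE : a \in [set u; w] by rewrite -E inE.
have cE : c \in [set u; w] by rewrite -E inE.
rewrite /other; case: pickP => [z|/(_ c)] /=; last by rewrite !inE ebc eq_sym ac.
rewrite 2!inE E => /andP[za zE]; move: aE cE zE ac za; rewrite !inE.
do 3![case/orP=> /eqP->]; rewrite ?eqxx //.
Qed.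

(** Read backwards, a path through vertices of degree 2 up to [S] is a walk that never has a choice,
    so it is determined by its first edge out of [S] and its length. This makes such paths countable
    in [bare_path]. *)
Lemma path_walk v w p : path e v (w :: p) -> last w p \in S -> uniq (v :: w :: p) ->
  all (predC [in S]) (belast v (w :: p)) ->
  exists s y, [/\ s \in S, e s y & iter (size p) step (s, y) = (w, v)].
Proof.
elim: p v w => [|u p IH] v w /=.
  by rewrite andbT => evw wS _ _; exists w, v; split=> //; rewrite e_sym.
case/and3P=> evw ewu up lS /andP[vN wN] /andP[vS aS].
have [s [y [sS esy E]]] : exists s y, [/\ s \in S, e s y & iter (size p) step (s, y) = (u, w)].
  by apply: IH => //=; rewrite ewu.
exists s, y; split=> //; rewrite E /step /=; congr pair.
case/andP: aS; rewrite !inE negbK => /eqP w2 _.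
apply: other_nbr; rewrite ?w2 //; first by rewrite e_sym.
by apply: contraNneq vN => <-; rewrite !inE eqxx orbT.
Qed.

Lemma bare_path M : 0 < #|S| -> #|S| + M * \sum_(s in S) deg e s < #|T| ->
  exists x : nat -> T,
    [/\ forall a b, a <= M -> b <= M -> x a = x b -> a = b,
        forall a, a <= M -> deg e (x a) = 2 & forall a, a < M -> e (x a) (x a.+1)].
Proof.
move=> S0 lt.
(* [W] holds all vertices that forced walks from [S] can reach within [M] edges. From a vertex
   outside [W], a path to [S] starts with [M + 1] vertices of degree 2. *)
pose W := S :|: \bigcup_(s in S) \bigcup_(k < M) ((fun y => (iter k step (s, y)).2) @: nbr e s).
have [|v _ vW] := @exists_notin _ [set: T] W.
  rewrite cardsT; apply: leq_ltn_trans lt; apply: leq_trans (leq_card_setU _ _) _.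
  rewrite leq_add2l big_distrr /=; apply: leq_trans (card_bigcup_leq _ _) _.
  apply: leq_sum => s _; apply: leq_trans (card_bigcup_leq _ _) _.
  rewrite -[M in M * _]card_ord -sum_nat_const; apply: leq_sum => k _; exact: leq_imset_card.
have [p [vp lS up aS]] := path_to_branch conn v S0.
have ltM : M < size p.
  rewrite ltnNge; apply: contra vW => leM.
  case: p vp lS up aS leM => [|w p] vp lS up aS leM; first by rewrite inE lS.
  have [s [y [sS esy E]]] := path_walk vp lS up aS.
  rewrite inE; apply/orP; right; apply/bigcupP; exists s => //.
  apply/bigcupP; exists (Ordinal leM) => //; apply/imsetP; exists y; rewrite ?in_nbr //=.
  by rewrite E.
exists (nth v (v :: p)); split.
- move=> a b aM bM /eqP; rewrite nth_uniq // ?ltnS; first by move/eqP.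
  + exact: leq_trans aM (ltnW ltM).
  + exact: leq_trans bM (ltnW ltM).
- move=> a aM; have alt : a < size p := leq_ltn_trans aM ltM.
  have : nth v (v :: p) a \in belast v p.
    have -> : nth v (v :: p) a = nth v (belast v p) a.
      by rewrite lastI nth_rcons size_belast alt.
    by rewrite mem_nth // size_belast.
  by move/(allP aS); rewrite !inE negbK => /eqP.
- by move=> a aM; apply: (pathP v vp); apply: ltn_trans ltM.
Qed.

End BarePath.

(** * Visiting the star centres *)

(* Greedily, from the largest index down: the index with [q] larger ones has at least [q] heads to choose from,
   and the largest one opens a new chain. *)
Lemma distinct_heads (t : nat) (A : {set 'I_t}) (Hd : 'I_t -> {set 'I_t}) :
  {in A, forall j : 'I_t, #|[set k in A | j < k]| <= #|Hd j|} ->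
  exists (Op : {set 'I_t}) (pr : 'I_t -> 'I_t),
    [/\ Op \subset A, #|Op| = (A != set0), {in A :\: Op, forall j, pr j \in Hd j} &
        {in A :\: Op &, injective pr}].
Proof.
move: {2}#|A| (leqnn #|A|) => m; elim: m A => [|m IH] A.
  rewrite leqn0 cards_eq0 => /eqP-> _; exists set0, id.
  by rewrite sub0set cards0 eqxx setD0; split=> // x; rewrite inE.
move=> le hA; have [E|A0] := eqVneq A set0.
  exists set0, id.
  by rewrite sub0set cards0 E setD0; split=> // x; rewrite inE.
have [j0 j0A] := set0Pn _ A0.
have [j jA jmin] := arg_minnP (fun j : 'I_t => val j) j0A.
have {}jA : j \in A by [].
have gtj k : k \in A -> k != j -> j < k.
  by move=> kA kj; rewrite ltn_neqAle jmin // andbT eq_sym.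
have cA := cardsD1 j A; rewrite jA in cA.
have [|k|Op [pr [sOp cOp prH prI]]] := IH (A :\ j).
- by move: le; rewrite cA.
- case/setD1P=> kj kA; apply: leq_trans (hA _ kA); apply/subset_leq_card/subsetP => l.
  by rewrite !inE => /andP[/andP[_ ->]].
have [A1|A1] := eqVneq (A :\ j) set0.
  exists A, pr; rewrite subxx cA A1 cards0 setDv; split=> // x; rewrite inE //.
rewrite A1 /= in cOp.
have HjA : #|A :\ j| <= #|Hd j|.
  apply: leq_trans (hA _ jA); apply/subset_leq_card/subsetP => k /setD1P[kj kA].
  by rewrite inE kA gtj.
(* One of the larger indices opens a chain, so only [#|A :\ j| - 1] heads are taken. *)
have [|p pH pN] := @exists_notin _ (Hd j) (pr @: ((A :\ j) :\: Op)).
  apply: leq_ltn_trans (leq_imset_card _ _) _; rewrite cardsD (setIidPr sOp) cOp.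
  by rewrite subn1; apply: leq_trans HjA; rewrite ltn_predL card_gt0.
exists Op, (fun x => if x == j then p else pr x); split.
- by apply: subset_trans sOp _; apply: subD1set.
- by rewrite cOp.
- by move=> k /setDP[kA kO]; case: eqP => [->//|/eqP kj]; apply: prH; rewrite !inE kj kA kO.
- move=> k l /setDP[kA kO] /setDP[lA lO] /=.
  case: eqVneq => [->|kj]; case: eqVneq => [->//|lj].
  + by move=> E; rewrite E imset_f ?inE ?lj ?lA ?lO in pN.
  + by move=> E; rewrite -E imset_f ?inE ?kj ?kA ?kO in pN.
  + by apply: prI; rewrite !inE ?kj ?lj ?kA ?lA ?kO ?lO.
Qed.

(* A maximal matching of unpaid pairs [j < k]: the larger one skips and pays for the smaller one to open a chain.
   Among the unmatched indices all pairs are paid, so that they have enough heads. *)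
Lemma star_decision (t : nat) (A : {set 'I_t}) (Hd : 'I_t -> {set 'I_t}) (paid : rel 'I_t) :
  {in A, forall j : 'I_t, #|[set k in A | (j < k) && paid j k]| <= #|Hd j|} ->
  exists (Sk Op : {set 'I_t}) (pr phi : 'I_t -> 'I_t),
   [/\ [/\ Sk \subset A, Op \subset A, [disjoint Sk & Op] & #|Op| <= #|Sk| + 1],
       {in A :\: Sk :\: Op, forall j, pr j \in Hd j}, {in A :\: Sk :\: Op &, injective pr},
       {in Sk, forall k : 'I_t, [&& phi k \in Op, phi k < k & ~~ paid (phi k) k]} &
       {in Sk &, injective phi}].
Proof.
move: {2}#|A| (leqnn #|A|) => m; elim: m A => [|m IH] A.
  rewrite leqn0 cards_eq0 => /eqP-> _; exists set0, set0, id, id.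
  rewrite !sub0set cards0 !setD0; split=> [|x|x|x|x]; rewrite ?inE //.
  by split=> //; rewrite disjoints_subset sub0set.
move=> le hA.
have [/exists_inP[j jA /exists_inP[k kA /andP[jk unp]]]|] :=
  boolP [exists j in A, [exists k in A, (j < k) && ~~ paid j k]]; last first.
  move=> /exists_inPn allp.
  have [j jA|Op [pr [sOp cOp prH prI]]] := @distinct_heads _ A Hd.
    apply: leq_trans (hA _ jA); apply/subset_leq_card/subsetP => k; rewrite !inE.
    case/andP=> kA jk; rewrite kA jk /=; have /exists_inPn/(_ k kA) := allp _ jA.
    by rewrite jk negbK.
  exists set0, Op, pr, id; rewrite sub0set setD0 cards0 cOp leq_b1; split=> //; try by move=> x; rewrite inE.
  by split=> //; rewrite disjoints_subset sub0set.
have kj : k != j by apply: contraTneq jk => ->; rewrite ltnn.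
pose A' := A :\ j :\ k.
have sA' : A' \subset A by apply/subsetP => x; rewrite !inE => /and3P[].
have [|l lA'|Sk [Op [pr [phi [[sSk sOp dS cO] prH prI phiH phiI]]]]] := IH A'.
- move: le; rewrite (cardsD1 j A) jA (cardsD1 k (A :\ j)) !inE kA kj !add1n !ltnS.
  exact: ltnW.
- have lA := subsetP sA' _ lA'.
  apply: leq_trans (hA _ lA); apply/subset_leq_card/subsetP => x.
  by rewrite !inE => /andP[/and3P[_ _ ->] ->].
have kSk : k \notin Sk by apply/negP => /(subsetP sSk); rewrite !inE eqxx.
have jSk : j \notin Sk by apply/negP => /(subsetP sSk); rewrite !inE eqxx andbF.
have kOp : k \notin Op by apply/negP => /(subsetP sOp); rewrite !inE eqxx.
have jOp : j \notin Op by apply/negP => /(subsetP sOp); rewrite !inE eqxx andbF.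
have AE : A :\: (k |: Sk) :\: (j |: Op) = A' :\: Sk :\: Op.
  by apply/setP => x; rewrite !inE; case: (x == j); case: (x == k); rewrite ?andbF ?andbT //=;
    case: (x \in A); rewrite ?andbF.
exists (k |: Sk), (j |: Op), pr, (fun x => if x == k then j else phi x); rewrite AE; split=> //.
- rewrite !subUset !sub1set kA jA (subset_trans sSk) ?(subset_trans sOp) //; split=> //.
    rewrite -setI_eq0; apply/eqP/setP => x; rewrite !inE.
    have := disjointFr dS; have := disjointFl dS => dl dr.
    case: (eqVneq x k) => [->|xk] /=; first by rewrite (negPf kj) (negPf kOp).
    case: (eqVneq x j) => [->|xj] /=; first by rewrite (negPf jSk).
    by apply/negP => /andP[/dr ->].
  by rewrite !cardsU1 kSk jOp; move: cO; clear; lia.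
- move=> x /setU1P[->|xS]; first by rewrite eqxx !inE eqxx jk unp.
  have [E|xk] := eqVneq x k; first by rewrite E (negPf kSk) in xS.
  by have /and3P[h1 h2 h3] := phiH _ xS; rewrite !inE h1 h2 h3 orbT.
- move=> x y /setU1P[->|xS] /setU1P[->|yS] //; rewrite ?eqxx.
  + case: eqVneq => [->//|_] E; have /andP[] := phiH _ yS; by rewrite -E (negPf jOp).
  + case: eqVneq => [->//|_] E; have /andP[] := phiH _ xS; by rewrite E (negPf jOp).
  + case: eqVneq => [E|_]; first by rewrite -E xS in kSk.
    case: eqVneq => [E|_]; first by rewrite -E yS in kSk.
    exact: phiI.
Qed.

(** * The schedule of visits to the centres *)

Section Scheme.

Variables (t : nat) (L P : {set 'I_t}).

(* [vis j i]: the path-like tree [j] visits the centre [c i]. It then comes from [c p] if [prd j i = Some p] and opens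
   a new chain if [prd j i = None]; a head is a centre where a chain can still be continued. [paid j k]: tree [k] has
   skipped a centre so that tree [j] could open a chain there; hence every tree skips at most as many centres as
   there are smaller path-like trees. *)
Definition heads (vis : rel 'I_t) (prd : 'I_t -> 'I_t -> option 'I_t) (j : 'I_t) : {set 'I_t} :=
  [set p | vis j p && [forall i, prd j i != Some p]].

(** The first cardinality clause is the budget at a centre. The last one provides the hypothesis of
    [star_decision] at the next centre. *)
Definition scheme_upto (k : nat) (vis : rel 'I_t) (prd : 'I_t -> 'I_t -> option 'I_t) (paid : rel 'I_t) : Prop :=
  [/\ [/\ forall j i, vis j i -> [&& i \in L, j \in P, j < i & i < k],
          forall j i p, prd j i = Some p -> [&& p < i, vis j p & vis j i],
          forall j i i' p, prd j i = Some p -> prd j i' = Some p -> i = i' &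
          forall j j' i p, prd j i = Some p -> prd j' i = Some p -> j = j'],
      forall i, i \in L -> i < k ->
        #|[set j in P | [&& j < i, vis j i & prd j i == None]]| <= #|[set j in P | (j < i) && ~~ vis j i]| + 1,
      forall j, j \in P -> #|[set i in L | [&& j < i, i < k & ~~ vis j i]]| <= #|[set l in P | (l < j) && paid l j]| &
      forall j, j \in P -> #|[set l in P | (j < l) && paid j l]| <= #|heads vis prd j|].

(** At the new centre a continuing tree exchanges one head for [i0]. An opening tree gains the head
    [i0] and receives at most one new payment, as [phi] is injective. A skipping tree pays a tree
    that it had not paid before. So both sides of each inequality keep pace. *)
Lemma scheme_step (i0 : 'I_t) vis prd paid : scheme_upto i0 vis prd paid ->
  exists vis' prd' paid', scheme_upto i0.+1 vis' prd' paid'.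
Proof.
case=> [[I0 I3 I4 I5] I2 I1 I6].
have [i0L|i0L] := boolP (i0 \in L); last first.
  have lt i : i \in L -> (i < i0.+1) = (i < i0).
    move=> iL; rewrite ltnS leq_eqVlt; case: eqVneq => //= E.
    by rewrite (val_inj E) (negPf i0L) in iL.
  exists vis, prd, paid; split=> //; first split=> //.
  - by move=> j i /I0 /and4P[-> -> -> ?]; rewrite ltnW.
  - by move=> i iL; rewrite lt //; apply: I2.
  - move=> j jP; apply: leq_trans (I1 _ jP); apply/subset_leq_card/subsetP => i.
    by rewrite !inE => /and4P[iL ? h ?]; rewrite lt // in h; apply/and4P.
pose A := [set j in P | j < i0].
have [j jA|Sk [Op [pr [phi [[sSk sOp dS cO] prH prI phiH phiI]]]]] := @star_decision _ A (heads vis prd) paid.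
  move: (jA); rewrite inE => /andP[jP _]; apply: leq_trans (I6 _ jP); apply/subset_leq_card/subsetP => l.
  by rewrite !inE => /andP[/andP[-> _] ->].
have vis0 j : vis j i0 = false by apply/negP => /I0; rewrite ltnn !andbF.
pose V := A :\: Sk; pose Q := A :\: Sk :\: Op.
pose vis' j i := if i == i0 then j \in V else vis j i.
pose prd' j i := if i == i0 then (if j \in Q then Some (pr j) else None) else prd j i.
pose paid' l j := paid l j || (j \in Sk) && (phi j == l).
have VA j : j \in V -> [&& j \in P, j < i0 & j \notin Sk].
  by rewrite !inE => /andP[-> /andP[-> ->]].
have QV j : j \in Q -> j \in V by rewrite /Q inE => /andP[].
have prQ j : j \in Q -> vis j (pr j) && [forall i, prd j i != Some (pr j)].
  by move=> jQ; have := prH _ jQ; rewrite inE.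
have viso j' p : vis j' p -> p != i0.
  by apply: contraTneq => ->; rewrite vis0.
exists vis', prd', paid'; split; first split.
- move=> j i; rewrite /vis'; case: eqP => [-> /VA/and3P[-> -> _]|_ /I0/and4P[-> -> -> ?]].
    by rewrite i0L leqnn.
  by rewrite ltnW.
- move=> j i p; rewrite /prd' /vis'; case: eqP => [->|_ /I3/and3P[pi vp vi]].
    case: ifP => // jQ [<-]; have /andP[v _] := prQ _ jQ; rewrite (negPf (viso _ _ v)) v QV // andbT.
    by have /and4P[_ _ _ ->] := I0 _ _ v.
  by rewrite (negPf (viso _ _ vp)) pi vp vi.
- move=> j i i' p; rewrite /prd'; case: (eqVneq i i0) => [->|ii0]; case: (eqVneq i' i0) => [->//|ii0'].
  + case: ifP => // jQ [<-] E; have /andP[_ /forallP/(_ i')] := prQ _ jQ; by rewrite E eqxx.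
  + move=> E; case: ifP => // jQ [E']; have /andP[_ /forallP/(_ i)] := prQ _ jQ; by rewrite E E' eqxx.
  + exact: I4.
- move=> j j' i p; rewrite /prd'; case: eqP => [_|_]; last exact: I5.
  by case: ifP => // jQ [<-]; case: ifP => // jQ' [E]; apply: prI; rewrite ?E.
- move=> i iL; rewrite ltnS leq_eqVlt => /orP[/eqP/val_inj-> {i iL}|lt]; last first.
    have ne : (i == i0) = false by apply/negP => /eqP E; rewrite E ltnn in lt.
    by rewrite /vis' /prd' ne; apply: I2.
  rewrite /vis' /prd' eqxx; apply: leq_trans (leq_trans cO _); last first.
    rewrite leq_add2r; apply/subset_leq_card/subsetP => j jS; have := subsetP sSk _ jS.
    by rewrite !inE jS => /andP[-> ->].
  apply/subset_leq_card/subsetP => j; rewrite inE => /and4P[jP ji jV].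
  by case: ifP => // /negbT; rewrite /Q inE jV andbT negbK.
- move=> j jP; have [jS|jS] := boolP (j \in Sk).
    have /and3P[pO plt pun] := phiH _ jS.
    have pP : phi j \in P by have := subsetP sOp _ pO; rewrite inE => /andP[].
    apply: (@leq_trans #|i0 |: [set i in L | [&& j < i, i < i0 & ~~ vis j i]]|).
      apply/subset_leq_card/subsetP => i; rewrite /vis' !inE; case: eqVneq => //= ii0.
      case/and4P=> -> -> lt ->; rewrite andbT /=.
      by move: lt; rewrite ltnS leq_eqVlt (inj_eq val_inj) (negPf ii0).
    apply: (@leq_trans #|phi j |: [set l in P | (l < j) && paid l j]|); last first.
      apply/subset_leq_card/subsetP => l; rewrite /paid' !inE => /orP[/eqP->|/and3P[-> -> ->]//].
      by rewrite pP plt jS eqxx orbT.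
    rewrite !cardsU1 !inE (negPf pun) !andbF ltnn !andbF /= leq_add2l; exact: I1.
  apply: leq_trans (leq_trans (I1 _ jP) _); apply/subset_leq_card/subsetP => x; rewrite !inE.
    rewrite /vis'; case: eqVneq => [->|xi0] /and4P[xL jx lt v].
      by move: v; rewrite !inE jS jP jx.
    by rewrite xL jx v andbT /=; move: lt; rewrite ltnS leq_eqVlt (inj_eq val_inj) (negPf xi0).
  by case/and3P=> -> -> h; rewrite /paid' h.
- move=> j jP.
  have phiO l : l \in Sk -> phi l \in Op by case/phiH/and3P.
  have hsub : j \notin Op -> #|[set l in P | (j < l) && paid' j l]| <= #|heads vis prd j|.
    move=> jO; apply: leq_trans (I6 _ jP); apply/subset_leq_card/subsetP => l; rewrite !inE /paid'.
    case/and3P=> -> -> /orP[->//|/andP[/phiO lS /eqP E]]; by rewrite -E lS in jO.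
  have hd p : p \in heads vis prd j -> (j \in Q -> p != pr j) -> p \in heads vis' prd' j.
    move=> pH pp; move: pH; rewrite !inE => /andP[v /forallP h]; rewrite /vis' (negPf (viso _ _ v)) v /=.
    apply/forallP => i; rewrite /prd'; case: (i =P i0) => [_|_]; last exact: h.
    case: ifP => // jQ.
    by apply: contra (pp jQ) => /eqP[->].
  have hi0 : j \in V -> i0 \in heads vis' prd' j.
    move=> jV; rewrite inE /vis' eqxx jV /=; apply/forallP => i; rewrite /prd'.
    case: (i =P i0) => [_|_]; last by apply/eqP => /I3/and3P[_]; rewrite vis0.
    by case: ifP => // jQ; apply/eqP => -[E]; have /andP[] := prQ _ jQ; rewrite E vis0.
  have i0h : i0 \notin heads vis prd j by rewrite inE vis0.
  have [jO|jO] := boolP (j \in Op).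
    have jV : j \in V by rewrite inE (subsetP sOp _ jO) (disjointFl dS).
    have jQ : j \in Q = false by rewrite inE jO.
    apply: (@leq_trans #|i0 |: heads vis prd j|); last first.
      apply/subset_leq_card/subsetP => p /setU1P[->|pH]; [exact: hi0 | by apply: hd; rewrite ?jQ].
    rewrite cardsU1 i0h addnC.
    apply: (@leq_trans #|[set l in P | (j < l) && paid j l] :|: [set l in Sk | phi l == j]|).
      apply/subset_leq_card/subsetP => l; rewrite !inE /paid' => /and3P[-> -> /orP[->//|->]].
      by rewrite orbT.
    apply: leq_trans (leq_card_setU _ _) _; apply: leq_add; first exact: I6.
    apply/card_le1P => x; rewrite inE => /andP[xS /eqP xE] y; rewrite !inE.
    apply/andP/eqP => [[yS /eqP yE]|->]; last by rewrite xS xE.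
    by apply: phiI => //; rewrite xE yE.
  apply: leq_trans (hsub jO) _.
  have [jQ|jQ] := boolP (j \in Q); last first.
    by apply/subset_leq_card/subsetP => p pH; apply: hd => //; rewrite (negPf jQ).
  have prj : pr j \in heads vis prd j by apply: prH.
  apply: (@leq_trans #|i0 |: (heads vis prd j :\ pr j)|).
    by rewrite (cardsD1 (pr j) (heads vis prd j)) prj cardsU1 !inE vis0 /= andbF.
  apply/subset_leq_card/subsetP => p /setU1P[->|/setD1P[pp pH]]; first exact/hi0/QV.
  exact: hd.
Qed.

Lemma star_scheme : exists (vis : rel 'I_t) (prd : 'I_t -> 'I_t -> option 'I_t),
  [/\ forall j i p, prd j i = Some p -> [&& p < i, vis j p & vis j i],
      forall j i i' p, prd j i = Some p -> prd j i' = Some p -> i = i',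
      forall j j' i p, prd j i = Some p -> prd j' i = Some p -> j = j',
      forall i, i \in L ->
        #|[set j in P | [&& j < i, vis j i & prd j i == None]]| <= #|[set j in P | (j < i) && ~~ vis j i]| + 1 &
      (forall j, j \in P -> #|[set i in L | (j < i) && ~~ vis j i]| <= #|[set l in P | l < j]|) /\
      (forall j i, vis j i -> [&& i \in L, j \in P & j < i])].
Proof.
suff up k : k <= t -> exists vis prd paid, scheme_upto k vis prd paid.
  have [vis [prd [paid [[I0 I3 I4 I5] I2 I1 I6]]]] := up t (leqnn t).
  exists vis, prd; split=> //.
  - by move=> i iL; apply: I2.
  - split=> [j jP|j i /I0/and4P[-> -> ->]//].
    apply: leq_trans (leq_trans (I1 _ jP) _); apply/subset_leq_card/subsetP => x; rewrite !inE.
      by case/and3P=> -> -> ->; rewrite ltn_ord.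
    by case/and3P=> -> ->.
elim: k => [_|k IH lt]; last first.
  by have [vis [prd [paid]]] := IH (ltnW lt); apply: (@scheme_step (Ordinal lt)).
exists (fun _ _ => false), (fun _ _ => None), (fun _ _ => false); split=> // [j|j] jP.
- by rewrite (_ : [set i in L | _] = set0) ?cards0 //; apply/setP => i; rewrite !inE ltn0 !andbF.
- by rewrite (_ : [set l in P | _] = set0) ?cards0 //; apply/setP => i; rewrite !inE !andbF.
Qed.

End Scheme.

(** * Laying out the chains along a bare path *)

Section ChainPositions.

Variables (t : nat) (prd : 'I_t -> option 'I_t).
Hypothesis prd_lt : forall i p, prd i = Some p -> p < i.
Hypothesis prd_inj : forall i i' p, prd i = Some p -> prd i' = Some p -> i = i'.

(* The first centre of the chain through [i], and the rank of [i] in this chain. *)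
Fixpoint chain (fuel : nat) (i : 'I_t) : 'I_t * nat :=
  if fuel is k.+1 then if prd i is Some p then ((chain k p).1, (chain k p).2.+1) else (i, 0) else (i, 0).

Lemma chain_fuel k (i : 'I_t) : i < k -> chain k i = chain i.+1 i.
Proof.
move: {2}(nat_of_ord i) (leqnn i) => m; elim: m k i => [|m IH] [//|k] i im ik.
  by rewrite /=; case E: (prd i) => [p|//]; have := prd_lt E; lia.
rewrite /=; case E: (prd i) => [p|//]; have pi := prd_lt E.
by rewrite (IH k p) ?(IH i p) //; lia.
Qed.

Let c (i : 'I_t) := chain i.+1 i.

Lemma chain_none i : prd i = None -> c i = (i, 0).
Proof. by rewrite /c /= => ->. Qed.

Lemma chain_some i p : prd i = Some p -> c i = ((c p).1, (c p).2.+1).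
Proof. by move=> E; rewrite /c /= E chain_fuel //; apply: prd_lt. Qed.

Lemma chain_rank_le (i : 'I_t) : (c i).2 <= i.
Proof.
move: {2}(nat_of_ord i) (leqnn i) => m; elim: m i => [|m IH] i im.
  by case E: (prd i) => [p|]; [have := prd_lt E; lia | rewrite chain_none].
case E: (prd i) => [p|]; last by rewrite chain_none.
have pi := prd_lt E; have pm : p <= m by rewrite -ltnS; apply: leq_trans im.
by rewrite (chain_some E) /=; apply: leq_ltn_trans (IH p pm) pi.
Qed.

Lemma chain_inj i i' : c i = c i' -> i = i'.
Proof.
move: {2}(c i).2 (erefl (c i).2) => r; elim: r i i' => [|r IH] i i'.
  case E: (prd i) => [p|]; first by rewrite (chain_some E).
  rewrite (chain_none E) => _; case E': (prd i') => [p'|]; first by rewrite (chain_some E').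
  by rewrite (chain_none E') => -[].
case E: (prd i) => [p|]; last by rewrite (chain_none E).
rewrite (chain_some E) => -[rE]; case E': (prd i') => [p'|]; last by rewrite (chain_none E').
rewrite (chain_some E') => -[e1 e2].
have pp : p = p' by apply: IH => //; rewrite [c p]surjective_pairing [c p']surjective_pairing e1 e2.
by apply: (prd_inj E); rewrite pp.
Qed.

Lemma chain_positions : exists pos : 'I_t -> nat,
  [/\ injective pos, forall i, 0 < pos i < t * t.+2,
      forall i p, prd i = Some p -> pos i = (pos p).+1 &
      forall i i', pos i = (pos i').+1 -> prd i = Some i'].
Proof.
(* Blocks of length [t + 2] keep different chains apart. *)
pose pos i := (c i).1 * t.+2 + (c i).2.+1.
have r_lt i : (c i).2 < t by apply: leq_ltn_trans (chain_rank_le i) (ltn_ord i).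
have r_lt2 i : (c i).2.+1 < t.+2 by rewrite ltnS ltnW ?ltnS ?r_lt.
have r_lt3 i : (c i).2.+2 < t.+2 by rewrite !ltnS r_lt.
have coords (q q' r r' : nat) : r < t.+2 -> r' < t.+2 -> q * t.+2 + r = q' * t.+2 + r' -> q = q' /\ r = r'.
  move=> hr hr' E; have := congr1 (divn^~ t.+2) E; rewrite !divnMDl // !divn_small // !addn0 => qE.
  by split=> //; move: E; rewrite qE => /addnI.
have same i i' : (c i).1 = (c i').1 :> nat -> (c i).2 = (c i').2 -> i = i'.
  by move=> /val_inj e1 e2; apply: chain_inj; rewrite [c i]surjective_pairing [c i']surjective_pairing e1 e2.
exists pos; split.
- move=> i i' /(coords _ _ _ _ (r_lt2 i) (r_lt2 i'))[e1 [e2]]; exact: (same _ _ e1 e2).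
- move=> i; rewrite /pos; have := ltn_ord (c i).1; have := r_lt i; nia.
- by move=> i p E; rewrite /pos (chain_some E) /= !addnS.
- move=> i i'; rewrite /pos -addnS => /(coords _ _ _ _ (r_lt2 i) (r_lt3 i'))[e1 [e2]].
  case E: (prd i) => [p|]; last by move: e2; rewrite (chain_none E).
  by move: e1 e2; rewrite (chain_some E) => e1 [e2]; rewrite (@same p i').
Qed.

End ChainPositions.

(** The vertex [xi i] is meant for the centre [c i]. An edge between two such vertices becomes an
    edge between two centres, so it must be a step recorded in [prd]: only recorded steps are known
    to differ from tree to tree. *)
Definition attachment (t : nat) (T : finType) (e : rel T) (Vs : {set 'I_t})
    (prd : 'I_t -> option 'I_t) (xi : 'I_t -> T) : Prop :=
  [/\ {in Vs &, injective xi},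
      {in Vs &, forall i i', e (xi i) (xi i') -> prd i = Some i' \/ prd i' = Some i},
      (forall i p, prd i = Some p -> e (xi i) (xi p)) &
      forall i, deg e (xi i) <= 2].

Lemma attachment_bare (t : nat) (T : finType) (e : rel T) (Vs : {set 'I_t}) (prd : 'I_t -> option 'I_t) x :
  symmetric e ->
  (forall i p, prd i = Some p -> p < i) ->
  (forall i i' p, prd i = Some p -> prd i' = Some p -> i = i') ->
  (forall a b, a <= t * t.+2 -> b <= t * t.+2 -> x a = x b -> a = b) ->
  (forall a, a <= t * t.+2 -> deg e (x a) = 2) ->
  (forall a, a < t * t.+2 -> e (x a) (x a.+1)) ->
  exists xi, attachment e Vs prd xi.
Proof.
move=> e_sym plt pinj x_inj x2 xe.
have [pos [pos_inj pos_lt pos_prd prd_pos]] := chain_positions plt pinj.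
have le i : pos i <= t * t.+2 by have /andP[_ /ltnW] := pos_lt i.
exists (fun i => x (pos i)); split.
- by move=> i i' _ _ /x_inj E; apply: pos_inj; apply: E.
- move=> i i' _ _ eii.
  have /andP[gt0 lt] := pos_lt i.
  have : x (pos i') \in [set x (pos i).-1; x (pos i).+1].
    suff <- : nbr e (x (pos i)) = [set x (pos i).-1; x (pos i).+1] by rewrite inE.
    apply/esym/eqP; rewrite eqEcard subUset !sub1set !inE xe // e_sym.
    have := @xe (pos i).-1; rewrite prednK // => -> /=; last by lia.
    rewrite -/(deg e _) x2 // cards2; case: eqP => // /x_inj E.
    have : (pos i).-1 = (pos i).+1 by apply: E; lia.
    lia.
  rewrite !inE => /orP[] /eqP /x_inj E.
    left; apply: prd_pos; have -> : pos i' = (pos i).-1 by apply: E => //; apply: leq_trans (leq_pred _) _.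
    by rewrite prednK.
  by right; apply: prd_pos; apply: E.
- by move=> i p E; rewrite (pos_prd _ _ E) e_sym xe //; have /andP[] := pos_lt i; rewrite (pos_prd _ _ E) => _ /ltnW.
- by move=> i; rewrite x2.
Qed.

Lemma attachment_leaves (t : nat) (T : finType) (e : rel T) (Vs : {set 'I_t}) :
  symmetric e -> irreflexive e -> connected_graph e -> 2 < #|T| -> t <= #|[set x | deg e x == 1]| ->
  exists2 xi, attachment e Vs (fun _ => None) xi & forall i, deg e (xi i) = 1.
Proof.
move=> e_sym e_irr conn T3 tl.
have [x0 _] : exists x0 : T, x0 \in T by apply/card_gt0P; apply: leq_trans T3.
have [|xi [xi_inj xiL]] := @exists_injection 'I_t _ x0 [set: 'I_t] [set x | deg e x == 1].
  by rewrite cardsT card_ord.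
have leaf i : deg e (xi i) = 1 by have := xiL i (in_setT _); rewrite inE => /eqP.
exists xi => //; split=> //; last by move=> i; rewrite leaf.
  by move=> i i' _ _; apply: xi_inj; rewrite inE.
move=> i i' _ _ eii; exfalso.
(* Two adjacent leaves form a connected component. *)
have /cards1P[y yE] : #|nbr e (xi i)| == 1 by have := leaf i; rewrite /deg => ->.
have /cards1P[z zE] : #|nbr e (xi i')| == 1 by have := leaf i'; rewrite /deg => ->.
have yi : y = xi i' by apply/eqP; rewrite eq_sym -in_set1 -yE inE.
have zi : z = xi i by apply/eqP; rewrite eq_sym -in_set1 -zE inE e_sym.
have cl : closed e [set xi i; xi i'].
  apply: (intro_closed (sym_connect_sym e_sym)) => a b eab; rewrite !inE => /orP[] /eqP aE; move: eab; rewrite aE.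
    by rewrite -in_nbr yE inE yi => ->; rewrite orbT.
  by rewrite -in_nbr zE inE zi => ->.
have : #|T| <= 2.
  rewrite -cardsT; apply: (@leq_trans #|[set xi i; xi i']|); last by rewrite cards2; case: (_ != _).
  apply/subset_leq_card/subsetP => w _.
  by rewrite -(closed_connect cl (conn (xi i) w)) !inE eqxx.
by rewrite leqNgt T3.
Qed.

(** By [sum_deg_branch] at most [2 * t] vertices have degree other than 2, with total degree at most
    [4 * t]. The bound on [#|T|] then yields a bare path of length [t * t.+2], as [chain_positions]
    requires. *)
Lemma attachment_few_leaves (t : nat) (T : finType) (e : rel T) (Vs : {set 'I_t}) (prd : 'I_t -> option 'I_t) :
  is_tree e -> #|[set x | deg e x == 1]| <= t -> 2 * t + t * t.+2 * (4 * t) < #|T| -> 1 < #|T| ->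
  (forall i p, prd i = Some p -> p < i) ->
  (forall i i' p, prd i = Some p -> prd i' = Some p -> i = i') ->
  exists xi, attachment e Vs prd xi.
Proof.
move=> tr few lt T1 plt pinj; have [[e_sym e_irr] _ conn _] := tr.
have dgn := tree_degenerate tr; have dpos := tree_deg_gt0 tr T1.
have [sS cS] := sum_deg_branch e_sym e_irr dgn dpos few.
have S0 : 0 < #|[set x | deg e x != 2]|.
  rewrite lt0n cards_eq0; apply/eqP => S0.
  have := sum_deg e_sym e_irr dgn.
  have -> : \sum_x deg e x = \sum_(x : T) 2.
    by apply: eq_bigr => x _; have := in_set0 x; rewrite -S0 inE => /negbFE/eqP.
  rewrite sum_nat_const -[#|_|]/(#|T|); move: T1; lia.
have [|x [x_inj x2 xe]] := bare_path e_sym conn (M := t * t.+2) S0.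
  apply: leq_ltn_trans lt; apply: leq_add => //; by rewrite leq_mul2l sS orbT.
exact: (attachment_bare _ e_sym plt pinj x_inj x2 xe).
Qed.

(** * Embedding one tree *)

(** Every earlier choice rules out at most [r] candidates. The demand depends on the position in
    [zs], so elements served early can do with few candidates. *)
Lemma greedy_choice (T B : finType) (t0 : T) (R : rel T) (Cand : B -> {set T}) (r : nat) (zs : seq B) :
  uniq zs -> {in zs, forall b, {in Cand b, forall x, #|[set y | R x y]| <= r}} ->
  {in zs, forall b, r * index b zs < #|Cand b|} -> symmetric R ->
  exists h : B -> T, {in zs, forall b, h b \in Cand b} /\
    {in zs &, forall b b', b != b' -> ~~ R (h b) (h b')}.
Proof.
move=> uz Rr big R_sym; elim/last_ind: zs uz Rr big => [|zs b IH]; first by exists (fun _ => t0).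
rewrite rcons_uniq => /andP[bz uz] Rr big.
have mr b' : b' \in zs -> b' \in rcons zs b by rewrite mem_rcons inE orbC => ->.
have idx b' : b' \in zs -> index b' (rcons zs b) = index b' zs.
  by move=> zb; rewrite -cats1 index_cat zb.
have [|b' zb|h [hC hR]] := IH uz.
- by move=> b' /mr; apply: Rr.
- by rewrite -(idx _ zb); apply/big/mr.
have [|x xC xN] := @exists_notin _ (Cand b) (\bigcup_(i < size zs) [set y | R (h (nth b zs i)) y]).
  apply: leq_ltn_trans (card_bigcup_leq _ _) _.
  apply: leq_ltn_trans (big b _); last by rewrite mem_rcons inE eqxx.
  rewrite -cats1 index_cat (negPf bz) /= eqxx addn0 mulnC.
  rewrite -[size zs in leqRHS]card_ord -sum_nat_const; apply: leq_sum => i _.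
  by have zi := mem_nth b (ltn_ord i); apply: (Rr _ (mr _ zi)); apply: hC.
have nR b' : b' \in zs -> ~~ R (h b') x.
  move=> zb; apply: contra xN => Rx; have lt : index b' zs < size zs by rewrite index_mem.
  by apply/bigcupP; exists (Ordinal lt); rewrite // inE nth_index.
exists (fun b' => if b' == b then x else h b'); split.
  move=> b'; rewrite mem_rcons inE; case: eqP => [->|_] //=; exact: hC.
move=> b1 b2; rewrite !mem_rcons !inE.
case: (eqVneq b1 b) => [->|n1]; case: (eqVneq b2 b) => [->|n2] //=; rewrite ?eqxx //.
- by move=> _ /nR; rewrite R_sym.
- by move=> /nR.
- exact: hR.
Qed.

(** A vertex with at most one neighbour in [S] is placed last. It has to avoid the hosts given to
    the rest of [S] and the [H]-neighbours of at most [1 + #|X|] hosts, each of degree at most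
    [d]. *)
Lemma place_greedily (T V : finType) (e : rel T) (H : rel V) (X S : {set T}) (g : T -> V) (Ok : {set V}) (d : nat) :
  symmetric e -> irreflexive e -> degenerate e -> symmetric H ->
  [disjoint X & S] -> {in X, forall x, deg H (g x) <= d} -> {in Ok, forall u, deg H u <= d} ->
  #|S| + d * (1 + #|X|) <= #|Ok| ->
  exists g' : T -> V, [/\ {in X, g' =1 g}, {in S, forall x, g' x \in Ok}, {in S &, injective g'} &
    {in S & X :|: S, forall x y, e x y -> ~~ H (g' x) (g' y)}].
Proof.
move=> e_sym e_irr dgn H_sym dXS dX dOk.
move: {2}#|S| (leqnn #|S|) => m; elim: m S dXS => [|m IH] S dXS.
  by rewrite leqn0 cards_eq0 => /eqP-> _; exists g; split=> // [x|x y|x y]; rewrite inE.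
have [->|S0] := eqVneq S set0; first by exists g; split=> // [x|x y|x y]; rewrite inE.
move=> le hOk; have [x xS x1] := dgn S S0.
have cS := cardsD1 x S; rewrite xS in cS.
have [|||g1 [gX gS gI gH]] := IH (S :\ x); try by lia.
  by apply: disjointWr dXS; apply: subD1set.
pose W := (nbr e x :&: S) :|: X.
have xX : x \notin X by rewrite (disjointFl dXS xS).
have dW w : w \in W -> deg H (g1 w) <= d.
  case/setUP=> [|wX]; last by rewrite gX // dX.
  rewrite !inE => /andP[exw wS]; apply/dOk/gS; rewrite !inE wS andbT.
  by apply: contraTneq exw => ->; rewrite e_irr.
have [|u uOk uN] := @exists_notin _ Ok ((g1 @: (S :\ x)) :|: \bigcup_(w in W) nbr H (g1 w)).
  apply: leq_ltn_trans (leq_card_setU _ _) _; apply: leq_trans hOk; rewrite cS addSn ltnS.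
  apply: leq_add; first exact: leq_imset_card.
  apply: leq_trans (card_bigcup_leq _ _) _; apply: (@leq_trans (\sum_(w in W) d)).
    exact: leq_sum.
  rewrite sum_nat_const [leqLHS]mulnC; apply: leq_mul => //.
  by apply: leq_trans (leq_card_setU (nbr e x :&: S) X) _; rewrite -[(0 + _).+1]/(1 + #|X|) leq_add2r.
move: uN; rewrite inE negb_or => /andP[u1 u2].
have uH w : w \in W -> ~~ H u (g1 w).
  by move=> wW; apply: contra u2 => Hu; apply/bigcupP; exists w => //; rewrite in_nbr H_sym.
exists (fun y => if y == x then u else g1 y); split.
- by move=> y yX; case: eqP => [E|_]; [rewrite E (negPf xX) in yX | apply: gX].
- by move=> y yS; case: eqVneq => // yx; apply: gS; rewrite !inE yx.
- move=> y z yS zS /=; case: (eqVneq y x) => [->|yx]; case: (eqVneq z x) => [->|zx] //.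
  + by move=> E; rewrite E imset_f ?inE ?zx in u1.
  + by move=> E; rewrite -E imset_f ?inE ?yx in u1.
  + by apply: gI; rewrite !inE ?yx ?zx.
- move=> y z yS zXS eyz /=; case: (eqVneq y x) eyz => [->|yx] eyz; case: (eqVneq z x) eyz => [->|zx] eyz.
  + by rewrite e_irr in eyz.
  + by apply: uH; move: zXS; rewrite !inE eyz /= orbC.
  + by rewrite H_sym; apply: uH; rewrite !inE e_sym eyz yS.
  + apply: gH => //; first by rewrite !inE yx.
    by move: zXS; rewrite !inE zx.
Qed.

Section Step.

(* The tree [e] has its core [X0] placed by [g]; its other vertices go to [U]. [H] are the used edges, those at the
   star centres [Cs] excepted, and [Fut] the hosts reserved for later trees, with blocks [Qa i] and [Qb i]. The
   vertices in [P] and [Q] are small and have no common big neighbour; [al] and [be] contain the big neighbours of the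
   subsets [P0] and [Q0], so that by [pair_now] every host may receive the vertices of [P0] or those of [Q0]. *)
Variables (T V I : finType) (t0 : T) (e : rel T) (H : rel V).
Variables (X0 al be P Q P0 Q0 : {set T}) (g : T -> V) (U Cs Fut : {set V}) (Qa Qb : I -> {set V}).
Variables (D d M lam hh bg hi sS bB : nat).

Hypotheses (e_sym : symmetric e) (e_irr : irreflexive e) (e_dgn : degenerate e) (H_sym : symmetric H).
Hypotheses (g_inj : {in X0 &, injective g}) (g_out : {in X0, forall x, g x \notin U}).
Hypotheses (g_fut : {in X0, forall x, g x \notin Fut}) (card_U : #|~: X0| <= #|U|).
Hypothesis H_Cs : forall u v, H u v -> u \notin Cs.
Hypothesis g_free : {in X0 &, forall x y, e x y -> ~~ H (g x) (g y)}.
Hypotheses (d_X0 : {in X0, forall x, deg H (g x) <= d}) (d_Fut : {in Fut, forall u, deg H u <= d}).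
Hypothesis H_hh : forall u, deg H u <= hh.
Hypothesis X0_Fut : {in X0 & Fut, forall x u, ~~ H (g x) u}.
Hypothesis Fut_Fut : {in Fut &, forall u v, ~~ H u v}.
Hypotheses (Qa_Fut : forall i, Qa i \subset Fut) (Qb_Fut : forall i, Qb i \subset Fut).
Hypothesis Qab : forall i j, [disjoint Qa i & Qb j].
Hypotheses (al_X0 : al \subset X0) (be_X0 : be \subset X0).
Hypothesis pair_now : forall v, {in al & be, forall x y, ~~ (H v (g x) && H v (g y))}.
Hypothesis small_PQ : {in P :|: Q, forall x, (x \notin X0) && (deg e x < D)}.
Hypothesis PQ_big : forall w, {in P & Q, forall x y, e w x -> e w y -> D <= deg e w -> (w \in X0) && (g w \in Cs)}.
Hypotheses (P0_sub : P0 \subset P) (Q0_sub : Q0 \subset Q).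
Hypothesis P0_big : {in P0, forall x w, e x w -> (D <= deg e w) || (w \in X0) ->
  (w \in al) || (w \in X0) && (g w \in Cs)}.
Hypothesis Q0_big : {in Q0, forall x w, e x w -> (D <= deg e w) || (w \in X0) ->
  (w \in be) || (w \in X0) && (g w \in Cs)}.

Let z := sS + bB + #|Fut|.
Let r := (1 + D + D * D).
Let Mk := M + #|Fut| * (1 + d).

Hypothesis card_big : #|[set w | D <= deg e w]| <= bg.
Hypothesis card_high : #|[set u | d < deg H u]| <= hi.
Hypothesis card_high' : #|[set u | M < deg H u]| <= bB.
Hypothesis room_big : bg + d * (1 + #|X0|) + hi + #|Fut| + #|Fut| * d <= #|U|.
Hypothesis d_M : d <= M.
Hypothesis room_sS : #|T|.*2 * d < sS.+1 * lam.
Hypotheses (room_P0 : r * sS < #|P0|) (room_Q0 : r * sS < #|Q0|).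
Hypotheses (room_P : r * z + lam < #|P|) (room_Q : r * z + lam < #|Q|).
Hypothesis room_swap : 2 * (D * Mk) + (hh + #|Fut|) + lam + D + 1 + bg + z < #|U|.

Let NF : {set V} := \bigcup_(q in Fut) nbr H q.

Lemma in_NF v : (v \in NF) = [exists q in Fut, H v q].
Proof.
apply/bigcupP/exists_inP => -[q qF h]; exists q => //; first by move: h; rewrite in_nbr H_sym.
by rewrite in_nbr H_sym.
Qed.

Lemma card_NF : #|NF| <= #|Fut| * d.
Proof.
apply: leq_trans (card_bigcup_leq _ _) _; rewrite -sum_nat_const; apply: leq_sum => q; exact: d_Fut.
Qed.

(* Virtual edges keep a neighbour of [Qa i] from becoming a neighbour of [Qb i] and vice versa. *)
Let virt u v := [exists i, (u \in Qa i) && [exists q in Qb i, H v q] || (u \in Qb i) && [exists q in Qa i, H v q]].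
Let K u v := [|| H u v, virt u v | virt v u].

Lemma virt_Fut u v : virt u v -> (u \in Fut) && (v \in NF).
Proof.
case/existsP=> i /orP[] /andP[uQ /exists_inP[q qQ Hq]]; rewrite in_NF.
  by rewrite (subsetP (Qa_Fut i)) //; apply/exists_inP; exists q => //; apply: (subsetP (Qb_Fut i)).
by rewrite (subsetP (Qb_Fut i)) //; apply/exists_inP; exists q => //; apply: (subsetP (Qa_Fut i)).
Qed.

Lemma K_sym : symmetric K.
Proof. by move=> u v; rewrite /K H_sym; congr (_ || _); rewrite orbC. Qed.

Lemma K_notin u v : u \notin Fut -> K u v -> H u v || (v \in Fut) && (u \in NF).
Proof.
move=> uF /or3P[->//|/virt_Fut/andP[]|/virt_Fut/andP[-> ->]]; last by rewrite orbT.
by rewrite (negPf uF).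
Qed.

Lemma K_in u v : u \in Fut -> K u v -> v \in NF.
Proof.
move=> uF /or3P[Huv|/virt_Fut/andP[_ ->]//|/virt_Fut/andP[vF]].
  by rewrite in_NF; apply/exists_inP; exists u; rewrite // H_sym.
by rewrite in_NF => /exists_inP[q qF]; rewrite (negPf (Fut_Fut uF qF)).
Qed.

Lemma deg_K_in u : u \in Fut -> deg K u <= Mk.
Proof.
move=> uF; apply: (@leq_trans #|NF|); last by apply: leq_trans card_NF _; rewrite /Mk mulnDr addnA leq_addl.
by apply/subset_leq_card/subsetP => v; rewrite in_nbr; apply: K_in.
Qed.

Lemma deg_K_notin u : u \notin Fut -> deg K u <= deg H u + #|Fut|.
Proof.
move=> uF; apply: leq_trans (leq_card_setU (nbr H u) Fut).
apply/subset_leq_card/subsetP => v; rewrite !inE => /(K_notin uF)/orP[->//|/andP[->]].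
by rewrite orbT.
Qed.

Let Bg := [set w | (w \notin X0) && (D <= deg e w)].
(** Virtual edges run between [Fut] and [NF], so a big vertex placed here meets none of them. *)
Let Ok := [set u in U | deg H u <= d] :\: (Fut :|: NF).

Lemma place_big : exists g1 : T -> V, [/\ {in X0, g1 =1 g}, {in Bg, forall x, g1 x \in Ok}, {in Bg &, injective g1} &
    {in Bg & X0 :|: Bg, forall x y, e x y -> ~~ H (g1 x) (g1 y)}].
Proof.
apply: (@place_greedily _ _ e H X0 Bg g Ok d) => //.
- by rewrite disjoints_subset; apply/subsetP => x xX; rewrite !inE xX.
- by move=> u; rewrite !inE => /and3P[].
have bB' : #|Bg| <= bg.
  by apply: leq_trans card_big; apply/subset_leq_card/subsetP => w; rewrite !inE => /andP[].
have := cardsID (Fut :|: NF) [set u in U | deg H u <= d]; rewrite -/Ok.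
have h1 : #|[set u in U | deg H u <= d] :&: (Fut :|: NF)| <= #|Fut| + #|Fut| * d.
  apply: leq_trans (subset_leq_card (subsetIr _ _)) _.
  by apply: leq_trans (leq_card_setU _ _) _; rewrite leq_add2l card_NF.
have h2 : #|U| <= #|[set u in U | deg H u <= d]| + hi.
  apply: leq_trans (_ : _ <= #|[set u in U | deg H u <= d] :|: [set u | d < deg H u]|) _.
    by apply/subset_leq_card/subsetP => u; rewrite !inE => ->; rewrite /= leqNgt orNb.
  by apply: leq_trans (leq_card_setU _ _) _; rewrite leq_add2l.
move: room_big h1 h2 bB'; clear; lia.
Qed.

Section Big.

Variable g1 : T -> V.
Hypotheses (g1_X0 : {in X0, g1 =1 g}) (g1_Bg : {in Bg, forall x, g1 x \in Ok}).
Hypothesis g1_Bg_inj : {in Bg &, injective g1}.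
Hypothesis g1_free' : {in Bg & X0 :|: Bg, forall x y, e x y -> ~~ H (g1 x) (g1 y)}.

Let X1 := X0 :|: Bg.
(* Swapping fails on hosts of [S], which see too many edges of the tree, and on hosts of [Bd]. *)
Let Lam u := \sum_(w | (w \in X1) && H u (g1 w)) deg e w.
Let S := [set u in U | lam < Lam u].
Let Bd := [set u | M < deg H u].
(** All these hosts receive a small vertex before the swapping starts, so that swapping only moves
    vertices among harmless hosts. [Fut] is included because whatever lands there has to be
    controlled. *)
Let Z := ((S :|: Bd :|: Fut) :&: U) :\: (g1 @: Bg).

Lemma g1_BgU x : x \in Bg -> [&& g1 x \in U, deg H (g1 x) <= d, g1 x \notin Fut & g1 x \notin NF].
Proof. by move/g1_Bg; rewrite !inE negb_or => /andP[/andP[-> ->] /andP[-> ->]]. Qed.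

Lemma g1_inj : {in X1 &, injective g1}.
Proof.
move=> x y /setUP[xX|xB] /setUP[yX|yB].
- by rewrite !g1_X0 //; apply: g_inj.
- rewrite (g1_X0 xX) => E; have /and4P[yU _ _ _] := g1_BgU yB.
  by have := g_out xX; rewrite E yU.
- rewrite (g1_X0 yX) => E; have /and4P[xU _ _ _] := g1_BgU xB.
  by have := g_out yX; rewrite -E xU.
- exact: g1_Bg_inj.
Qed.

Lemma g1_free : {in X1 &, forall x y, e x y -> ~~ H (g1 x) (g1 y)}.
Proof.
move=> x y /setUP[xX|xB] yX1 exy; last exact: g1_free'.
case/setUP: yX1 => [yX|yB]; first by rewrite !g1_X0 //; apply: g_free.
by rewrite H_sym; apply: g1_free' => //; [rewrite inE xX | rewrite e_sym].
Qed.

Lemma g1_deg x : x \in X1 -> deg H (g1 x) <= d.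
Proof. by case/setUP=> [xX|/g1_BgU/and4P[]//]; rewrite g1_X0 // d_X0. Qed.

Lemma g1_Fut x : x \in X1 -> g1 x \notin Fut.
Proof. by case/setUP=> [xX|/g1_BgU/and4P[]//]; rewrite g1_X0 // g_fut. Qed.

Lemma g1_NF x : x \in X1 -> g1 x \notin NF.
Proof.
case/setUP=> [xX|/g1_BgU/and4P[]//]; rewrite g1_X0 // in_NF.
by apply/exists_inPn => q qF; apply: X0_Fut.
Qed.

Lemma X1P w : (w \in X1) = (w \in X0) || (D <= deg e w).
Proof. by rewrite !inE; case: (w \in X0). Qed.

Lemma S_notFut u : u \in S -> u \notin Fut.
Proof.
rewrite inE => /andP[_ gt0]; apply: contraTN gt0 => uF; rewrite -leqNgt /Lam big_pred0 // => w.
by apply/negP => /andP[/g1_NF]; rewrite in_NF => /exists_inPn/(_ u uF); rewrite H_sym => /negPf->.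
Qed.

(** Double counting: each [w] in [X1] contributes [deg e w] to [Lam u] for at most [d] hosts [u], so
    the total of [Lam] is at most [d] times the degree sum of the tree. *)
Lemma card_S : #|S| <= sS.
Proof.
have h : lam * #|S| <= #|T|.*2 * d.
  apply: (@leq_trans (\sum_(u in S) Lam u)).
    by rewrite mulnC -sum_nat_const; apply: leq_sum => u; rewrite inE => /andP[_ /ltnW].
  apply: (@leq_trans (\sum_u Lam u)).
    by rewrite [leqRHS](bigID [in S]) leq_addr.
  rewrite /Lam (exchange_big_dep [in X1]) /=; last by move=> u w _ /andP[].
  apply: (@leq_trans (\sum_x deg e x * d)); last first.
    rewrite -big_distrl leq_mul2r /=; apply/orP; right.
    by apply: leq_trans (sum_deg e_sym e_irr e_dgn) _; rewrite leq_double leq_pred.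
  rewrite [leqRHS](bigID [in X1]) /=; apply: leq_trans (leq_addr _ _).
  apply: leq_sum => w wX; rewrite wX sum_nat_const mulnC leq_mul2l /=; apply/orP; right.
  apply: leq_trans (g1_deg wX); apply/subset_leq_card/subsetP => u.
  by rewrite !inE H_sym.
rewrite leqNgt; apply/negP => lt; move: room_sS; rewrite ltnNge; case/negP.
by apply: leq_trans h; rewrite mulnC leq_mul2l lt orbT.
Qed.

Lemma card_Z : #|Z| <= z.
Proof.
apply: (@leq_trans #|S :|: Bd :|: Fut|).
  by apply/subset_leq_card/subsetP => u; rewrite inE => /andP[_]; rewrite inE => /andP[].
apply: leq_trans (leq_card_setU _ _) _; rewrite leq_add2r.
by apply: leq_trans (leq_card_setU _ _) _; apply: leq_add; [exact: card_S | exact: card_high'].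
Qed.

(** Excluding common small neighbours has two uses: a small vertex gets at most one neighbour on a
    host of [Z], and no small vertex is joined to both [Qa i] and [Qb i]. *)
Let Rel x y := [|| x == y, e x y | [exists w, [&& deg e w < D, e w x & e w y]]].

Lemma card_Rel x : deg e x < D -> #|[set y | Rel x y]| <= r.
Proof.
move=> xD; apply: (@leq_trans #|[set x] :|: nbr e x :|: \bigcup_(w | e x w && (deg e w < D)) nbr e w|).
  apply/subset_leq_card/subsetP => y; rewrite !inE eq_sym => /or3P[->//|->|]; first by rewrite orbT.
  case/existsP=> w /and3P[wD ewx ewy]; apply/orP; right; apply/bigcupP; exists w; rewrite ?in_nbr //.
  by rewrite e_sym ewx.
apply: leq_trans (leq_card_setU _ _) _; apply: leq_add.
  by apply: leq_trans (leq_card_setU _ _) _; rewrite cards1 leq_add2l ltnW.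
apply: leq_trans (card_bigcup_leq _ _) _; apply: (@leq_trans (\sum_(w | e x w && (deg e w < D)) D)).
  by apply: leq_sum => w /andP[_ /ltnW].
rewrite sum_nat_const leq_mul2r; apply/orP; right; apply: leq_trans (ltnW xD).
by apply/subset_leq_card/subsetP => w; rewrite in_nbr => /andP[].
Qed.

Lemma Rel_sym : symmetric Rel.
Proof.
move=> x y; rewrite /Rel eq_sym e_sym; congr [|| _, _ | _]; apply: eq_existsb => w.
by congr (_ && _); rewrite andbC.
Qed.

(** A host of [S] that sees the host of a vertex in [al] sees none for [be], by [pair_now], so it
    accepts [Q0]; otherwise it accepts [P0]. In [Fut], the hosts of some [Qb i] get vertices of [Q]
    and the others vertices of [P], so that [PQ_big] governs common big neighbours. A remaining host
    [b] excludes at most [Lam b <= lam] vertices of [P]. *)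
Let Cand b := if b \in S then (if [exists x in al, H b (g x)] then Q0 else P0)
  else if b \in Fut then (if [exists i, b \in Qb i] then Q else P)
  else P :\: \bigcup_(w | (w \in X1) && H b (g1 w)) nbr e w.

Lemma Cand_PQ b x : x \in Cand b -> x \in P :|: Q.
Proof.
rewrite /Cand; case: ifP => _.
  by case: ifP => _ xC; rewrite inE ?(subsetP P0_sub _ xC) ?(subsetP Q0_sub _ xC) ?orbT.
case: ifP => _; first by case: ifP => _ xC; rewrite inE xC ?orbT.
by rewrite !inE => /andP[_ ->].
Qed.

Lemma Cand_free b x w : x \in Cand b -> w \in X1 -> e x w -> ~~ H b (g1 w).
Proof.
move=> xC wX exw; have wB : (D <= deg e w) || (w \in X0) by rewrite orbC -X1P.
have onCs : (w \in X0) && (g w \in Cs) -> ~~ H b (g1 w).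
  case/andP=> wX0 wC; rewrite g1_X0 // H_sym; apply: contraTN wC; exact: H_Cs.
move: xC; rewrite /Cand; case: ifP => bS.
  case: ifP => [/exists_inP[y ya Hy] xQ|/negbT/exists_inPn noH xP].
    have /orP[wb|/onCs//] := Q0_big xQ exw wB.
    by rewrite g1_X0 ?(subsetP be_X0) //; have := pair_now b ya wb; rewrite Hy.
  have /orP[wa|/onCs//] := P0_big xP exw wB.
  by rewrite g1_X0 ?(subsetP al_X0) // noH.
case: ifP => bF xC.
  by apply: contra (g1_NF wX) => Hb; rewrite in_NF; apply/exists_inP; exists b; rewrite // H_sym.
move: xC; rewrite inE => /andP[nx _]; apply: contra nx => Hb.
by apply/bigcupP; exists w; rewrite ?wX // in_nbr e_sym.
Qed.

Lemma card_Cand_S b : b \in S -> r * sS < #|Cand b|.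
Proof. by rewrite /Cand => ->; case: ifP. Qed.

Lemma card_Cand b : b \in Z -> b \notin S -> r * z < #|Cand b|.
Proof.
rewrite /Cand => bZ bS; rewrite (negPf bS).
have [hP hQ] : r * z < #|P| /\ r * z < #|Q|.
  by split; [apply: leq_ltn_trans room_P | apply: leq_ltn_trans room_Q]; apply: leq_addr.
case: ifP => _; first by case: ifP.
have bU : b \in U by move: bZ; rewrite inE => /andP[_]; rewrite inE => /andP[].
set A := \bigcup_(w | _) _; have cA : #|A| <= lam.
  apply: leq_trans (card_bigcup_leq _ _) _.
  by move: bS; rewrite inE bU /= -leqNgt.
have := cardsID A P; have := subset_leq_card (subsetIr P A); move: room_P cA; clear; lia.
Qed.

Lemma choose_small : exists h : V -> T, {in Z, forall b, h b \in Cand b} /\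
  {in Z &, forall b b', b != b' -> ~~ Rel (h b) (h b')}.
Proof.
(* The hosts of [S] are served first, since their candidate sets [P0] and [Q0] are only known to
   exceed [r * sS]. *)
have [|b bz x xC|b|h [hC hR]] :=
    @greedy_choice _ _ t0 Rel Cand r (enum (Z :&: S) ++ enum (Z :\: S)) _ _ _ Rel_sym.
- rewrite cat_uniq !enum_uniq /= andbT; apply/hasPn => b; rewrite !mem_enum !inE => /andP[/negPf-> _].
  by rewrite andbF.
- by apply: card_Rel; have /andP[] := small_PQ (Cand_PQ xC).
- rewrite mem_cat index_cat !mem_enum; case: ifP => [bZS _|bZS /= bZ].
    have bS : b \in S by case/setIP: bZS.
    apply: leq_ltn_trans (card_Cand_S bS); rewrite leq_mul2l; apply/orP; right.
    apply: leq_trans card_S; apply: leq_trans (subset_leq_card (subsetIr Z S)).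
    by rewrite cardE ltnW // index_mem mem_enum.
  have [bZ' bS] := setDP bZ; apply: leq_ltn_trans (card_Cand bZ' bS); rewrite leq_mul2l; apply/orP; right.
  apply: leq_trans card_Z; rewrite -(cardsID S Z) -!cardE leq_add2l.
  by rewrite cardE ltnW // index_mem mem_enum.
have inZ b : b \in Z -> b \in enum (Z :&: S) ++ enum (Z :\: S).
  by move=> bZ; rewrite mem_cat !mem_enum [_ \in Z :&: S]in_setI [_ \in Z :\: S]in_setD bZ andbT orbN.
exists h; split=> [b /inZ|b b' /inZ bz /inZ]; first exact: hC.
exact: hR.
Qed.

Section Small.

Variable h : V -> T.
Hypotheses (h_Cand : {in Z, forall b, h b \in Cand b}).
Hypothesis h_Rel : {in Z &, forall b b', b != b' -> ~~ Rel (h b) (h b')}.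

Let XZ := h @: Z.
Let X2 := X1 :|: XZ.
Let g2 x := if [pick b in Z | h b == x] is Some b then b else g1 x.
Let U2 := (U :\: (g1 @: Bg)) :\: Z.

Lemma h_inj : {in Z &, injective h}.
Proof.
move=> b b' bZ bZ' E; apply/eqP; apply: contraT => /(h_Rel bZ bZ').
by rewrite /Rel E eqxx.
Qed.

Lemma h_small b : b \in Z -> (h b \notin X0) && (deg e (h b) < D).
Proof. by move=> bZ; apply: small_PQ; apply: Cand_PQ (h_Cand bZ). Qed.

Lemma XZP x : reflect (exists2 b, b \in Z & x = h b) (x \in XZ).
Proof. exact: imsetP. Qed.

Lemma XZ_small x : x \in XZ -> [&& x \notin X0, deg e x < D & x \notin X1].
Proof.
case/XZP=> b bZ ->; have /andP[h1 h2] := h_small bZ.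
by rewrite h1 h2 X1P negb_or h1 -ltnNge.
Qed.

Lemma g2_h b : b \in Z -> g2 (h b) = b.
Proof.
move=> bZ; rewrite /g2; case: pickP => [b' /andP[bZ' /eqP E]|/(_ b)]; last by rewrite bZ eqxx.
exact: h_inj.
Qed.

Lemma g2_X1 x : x \in X1 -> g2 x = g1 x.
Proof.
move=> xX; rewrite /g2; case: pickP => [b /andP[bZ /eqP E]|//].
by have := XZ_small (imset_f h bZ); rewrite E xX !andbF.
Qed.

Lemma ZU b : b \in Z -> (b \in U) && (b \notin g1 @: Bg).
Proof. by rewrite inE => /andP[->]; rewrite inE => /andP[_ ->]. Qed.

Lemma g1_notZ x : x \in X1 -> g1 x \notin Z.
Proof.
move=> xX; apply/negP => /ZU/andP[gU gB].
case/setUP: xX => [xX|xB]; last by rewrite imset_f in gB.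
by have := g_out xX; rewrite -g1_X0 // gU.
Qed.

Lemma g2_inj : {in X2 &, injective g2}.
Proof.
move=> x y /setUP[xX|/XZP[b bZ ->]] /setUP[yX|/XZP[b' bZ' ->]].
- by rewrite !g2_X1 //; apply: g1_inj.
- by rewrite g2_X1 // g2_h // => E; have := g1_notZ xX; rewrite E bZ'.
- by rewrite g2_h // g2_X1 // => E; have := g1_notZ yX; rewrite -E bZ.
- by rewrite !g2_h // => ->.
Qed.

Lemma g2_out : {in X2, forall x, g2 x \notin U2}.
Proof.
move=> x /setUP[xX|/XZP[b bZ ->]]; last by rewrite g2_h // inE bZ.
rewrite g2_X1 //; case/setUP: xX => [xX|xB]; last by rewrite !inE imset_f // andbF.
by rewrite !inE g1_X0 // (negPf (g_out xX)) !andbF.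
Qed.

Lemma card_U2 : #|~: X2| <= #|U2| /\ #|U| <= #|U2| + bg + z.
Proof.
have dZ : [disjoint XZ & X1].
  by rewrite disjoints_subset; apply/subsetP => x /XZ_small/and3P[_ _]; rewrite in_setC.
have dB : [disjoint Bg & X0].
  by rewrite disjoints_subset; apply/subsetP => x; rewrite !inE => /andP[].
have cZ : #|XZ| = #|Z| by apply: card_in_imset; apply: h_inj.
have cB : #|g1 @: Bg| = #|Bg| by apply: card_in_imset.
have sB : g1 @: Bg \subset U by apply/subsetP => _ /imsetP[x /g1_BgU/and4P[xU _ _ _] ->].
have sZ : Z \subset U :\: (g1 @: Bg) by apply/subsetP => b /ZU/andP[h1 h2]; rewrite inE h1 h2.
have c1 := cardsID (g1 @: Bg) U; rewrite (setIidPr sB) cB in c1.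
have c2 := cardsID Z (U :\: (g1 @: Bg)); rewrite (setIidPr sZ) in c2.
have c3 := cardsC X2; have c4 := cardsC X0.
have c5 : #|X1| = #|X0| + #|Bg|.
  rewrite cardsU (_ : X0 :&: Bg = set0) ?cards0 ?subn0 //.
  by apply/eqP; rewrite setI_eq0 disjoint_sym.
have c6 : #|X2| = #|X1| + #|Z|.
  rewrite cardsU (_ : X1 :&: XZ = set0) ?cards0 ?subn0 ?cZ //.
  by apply/eqP; rewrite setI_eq0 disjoint_sym.
have bB' : #|Bg| <= bg.
  by apply: leq_trans card_big; apply/subset_leq_card/subsetP => w; rewrite !inE => /andP[].
move: card_Z card_U c1 c2 c3 c4 c5 c6 bB'; rewrite -/U2; clear; lia.
Qed.

Lemma g2_free : {in X2 &, forall x y, e x y -> ~~ K (g2 x) (g2 y)}.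
Proof.
have mixed b y : b \in Z -> y \in X1 -> e (h b) y -> ~~ K b (g1 y).
  move=> bZ yX ehy; apply/negP; case: (boolP (b \in Fut)) => bF.
    by move/(K_in bF); rewrite (negPf (g1_NF yX)).
  by move/(K_notin bF); rewrite (negPf (g1_Fut yX)) orbF (negPf (Cand_free (h_Cand bZ) yX ehy)).
move=> x y /setUP[xX|/XZP[b bZ ->]] /setUP[yX|/XZP[b' bZ' ->]] exy.
- rewrite !g2_X1 //; apply/negP => /(K_notin (g1_Fut xX)).
  by rewrite (negPf (g1_Fut yX)) orbF (negPf (g1_free xX yX exy)).
- by rewrite g2_X1 // g2_h // K_sym; apply: mixed; rewrite // e_sym.
- by rewrite g2_h // g2_X1 //; apply: mixed.
- have bb : b != b' by apply: contraTneq exy => ->; rewrite e_irr.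
  by have := h_Rel bZ bZ' bb; rewrite /Rel exy orbT.
Qed.

Lemma unfixed_host f x : extends_into X2 g2 U2 f -> x \notin X2 ->
  [&& f x \in U, f x \notin S, deg H (f x) <= M, f x \notin Fut & deg e x < D].
Proof.
move=> [_ _ fU] xX; have := fU _ xX; move: xX; rewrite /X2 inE negb_or X1P negb_or -ltnNge.
case/andP=> /andP[_ ->] _; rewrite /U2 [in f x \in _]inE => /andP[+ /setDP[fxU fxB]].
rewrite /Z in_setD fxB /= in_setI fxU andbT !in_setU !negb_or andbT => /andP[/andP[-> +] ->].
by rewrite inE -leqNgt => ->.
Qed.

Lemma f_X1 f x : extends_into X2 g2 U2 f -> x \in X1 -> f x = g1 x.
Proof. by case=> _ fg _ xX; rewrite fg ?g2_X1 // /X2 inE xX. Qed.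

(** A vertex outside [X2] has fewer than [D] neighbours, and by [Rel] at most one of them sits on a
    host of [Z]; hence the large bound [hh] enters only once. In the second sum, [X1] contributes at
    most [lam] because [f x] is not in [S], and the other vertices are small. *)
Lemma swap_room f x : extends_into X2 g2 U2 f -> x \notin X2 ->
  \sum_(w | e x w) deg K (f w) + \sum_(w | K (f x) (f w)) deg e w + deg e x + 1 < #|U2|.
Proof.
move=> vf xX; have /and5P[fxU fxS fxM fxF xD] := unfixed_host vf xX.
have [f_inj fg fU] := vf.
have M_Mk : M + #|Fut| <= Mk by rewrite /Mk leq_add2l leq_pmulr.
have d_Mk : d + #|Fut| <= Mk by apply: leq_trans M_Mk; rewrite leq_add2r.
have one : \sum_(w | e x w) (w \in XZ : nat) <= 1.
  have -> : \sum_(w | e x w) (w \in XZ : nat) = #|[set w in nbr e x | w \in XZ]|.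
    rewrite -sum1_card big_mkcond [RHS]big_mkcond; apply: eq_bigr => w _; rewrite !inE.
    by case: (e x w); case: (w \in XZ).
  apply/card_le1P => w; rewrite !inE => /andP[exw wZ] y; rewrite !inE.
  apply/andP/eqP => [[exy yZ]|->//]; apply/eqP; apply: contraT => yw.
  case/XZP: wZ exw yw => b bZ -> exb; case/XZP: yZ exy => b' bZ' -> exb' hb.
  have bb : b != b' by apply: contraNneq hb => ->.
  have := h_Rel bZ bZ' bb; rewrite /Rel !negb_or => /and3P[_ _ /existsPn/(_ x)].
  by rewrite xD exb exb'.
have s1 : \sum_(w | e x w) deg K (f w) <= D * Mk + (hh + #|Fut|).
  apply: (@leq_trans (\sum_(w | e x w) (Mk + (w \in XZ) * (hh + #|Fut|)))).
    apply: leq_sum => w _; have [wX|wX] := boolP (w \in X1).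
      rewrite (f_X1 vf wX); apply: leq_trans (leq_addr _ _).
      apply: leq_trans (deg_K_notin (g1_Fut wX)) _; apply: leq_trans d_Mk.
      by rewrite leq_add2r g1_deg.
    case: (boolP (w \in XZ)) => [wZ|wZ]; last first.
      have wX2 : w \notin X2 by rewrite inE negb_or wX.
      have /and5P[_ _ fwM fwF _] := unfixed_host vf wX2.
      rewrite addn0; apply: leq_trans (deg_K_notin fwF) _; apply: leq_trans M_Mk.
      by rewrite leq_add2r.
    rewrite mul1n; have [fwF|fwF] := boolP (f w \in Fut).
      by apply: leq_trans (deg_K_in fwF) _; apply: leq_addr.
    apply: leq_trans (deg_K_notin fwF) _; apply: leq_trans (leq_addl _ _).
    by rewrite leq_add2r H_hh.
  rewrite big_split sum_nat_const -big_distrl /=; apply: leq_add.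
    rewrite leq_mul2r; apply/orP; right; apply: leq_trans (ltnW xD).
    by apply/subset_leq_card/subsetP => w; rewrite in_nbr.
  by rewrite -[leqRHS]mul1n leq_mul2r one orbT.
have s2 : \sum_(w | K (f x) (f w)) deg e w <= lam + D * Mk.
  rewrite (bigID [in X1]) /=; apply: leq_add.
    apply: (@leq_trans (Lam (f x))); last by move: fxS; rewrite inE fxU /= -leqNgt.
    rewrite /Lam big_mkcond [leqRHS]big_mkcond; apply: leq_sum => w _.
    case: (boolP (w \in X1)) => wX; rewrite ?andbF //= ?andbT.
    rewrite (f_X1 vf wX); case: ifP => // /(K_notin fxF).
    by rewrite (negPf (g1_Fut wX)) orbF => ->.
  apply: (@leq_trans (\sum_(w | K (f x) (f w) && (w \notin X1)) D)).
    by apply: leq_sum => w /andP[_]; rewrite X1P negb_or -ltnNge => /andP[_ /ltnW].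
  rewrite sum_nat_const mulnC leq_mul2l; apply/orP; right.
  apply: (@leq_trans (deg K (f x))); last first.
    by apply: leq_trans (deg_K_notin fxF) _; apply: leq_trans M_Mk; rewrite leq_add2r.
  rewrite -(card_imset _ f_inj); apply/subset_leq_card/subsetP => _ /imsetP[w + ->].
  by rewrite in_nbr => /andP[].
have [_ cU] := card_U2; move: room_swap s1 s2 xD cU; clear; lia.
Qed.

Lemma step_embedding : exists f : T -> V, [/\ injective f,
  [/\ {in X0, f =1 g}, forall x, x \notin X0 -> f x \in U &
    forall x, x \notin X0 -> deg e x < D \/ deg H (f x) <= d],
  (forall x, f x \in Fut -> deg e x < D) /\ (forall x y, f x \in Fut -> f y \in Fut -> ~~ e x y),
  forall x y, e x y -> ~~ H (f x) (f y) &
  [/\ forall i x y w, f x \in Qa i -> f y \in Qb i -> e w x -> e w y -> f w \in Cs,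
    forall i x w q, f x \in Qa i -> q \in Qb i -> e w x -> ~~ H (f w) q &
    forall i x w q, f x \in Qb i -> q \in Qa i -> e w x -> ~~ H (f w) q]].
Proof.
have [cU _] := card_U2.
have [f vf fK] := swap_embedding e_sym K_sym e_irr g2_inj g2_out cU g2_free swap_room (g t0).
have [f_inj fg fU] := vf.
have fX0 x : x \in X0 -> f x = g x by move=> xX; rewrite (f_X1 vf) ?g1_X0 // inE xX.
have fBg x : x \in Bg -> f x = g1 x.
  by move=> xB; have xX1 : x \in X1 := subsetP (subsetUr _ _) _ xB; rewrite (f_X1 vf xX1).
have fZ x : x \in XZ -> f x \in Z /\ h (f x) = x.
  move=> xZ; have xX2 : x \in X2 by rewrite /X2 inE xZ orbT.
  by rewrite fg //; case/XZP: xZ => b bZ ->; rewrite g2_h.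
have FutZ x : f x \in Fut -> x \in XZ.
  move=> fF; have [xX|xX] := boolP (x \in X1).
    by move: fF; rewrite (f_X1 vf xX) (negPf (g1_Fut xX)).
  apply: contraLR fF => xZ; have xX2 : x \notin X2 by rewrite inE negb_or xX.
  by have /and5P[] := unfixed_host vf xX2.
have sm x : x \in XZ -> deg e x < D by case/XZ_small/and3P.
have RelZ x y : x \in XZ -> y \in XZ -> x != y -> ~~ Rel x y.
  move=> xZ yZ xy; have [fxZ hx] := fZ _ xZ; have [fyZ hy] := fZ _ yZ.
  by rewrite -hx -hy; apply: h_Rel => //; apply: contraNneq xy => /f_inj ->.
exists f; split=> //.
- split=> // [x xX|x xX].
    have [xB|xB] := boolP (x \in X1).
      rewrite (f_X1 vf xB); case/setUP: xB => [xX'|/g1_BgU/and4P[]//]; by rewrite xX' in xX.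
    have [xZ|xZ] := boolP (x \in XZ); first by have [/ZU/andP[]] := fZ _ xZ.
    have xX2 : x \notin X2 by rewrite /X2 inE negb_or xB.
    by have /and5P[] := unfixed_host vf xX2.
  have [xD|xD] := ltnP (deg e x) D; [by left | right].
  have xB : x \in Bg by rewrite inE xX.
  by rewrite fBg //; have /and4P[] := g1_BgU xB.
- split=> [x /FutZ/sm//|x y /FutZ xZ /FutZ yZ].
  case: (eqVneq x y) => [->|xy]; first by rewrite e_irr.
  by have := RelZ _ _ xZ yZ xy; rewrite /Rel !negb_or => /and3P[].
- move=> x y exy; have := fK _ _ exy; by rewrite /K negb_or => /andP[].
- have virtH u v : ~~ K u v -> ~~ virt u v by rewrite /K !negb_or => /and3P[].
  split=> [i x y w fx fy ewx ewy|i x w q fx qQ ewx|i x w q fx qQ ewx]; last 2 first.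
  + have := virtH _ _ (fK x w _); rewrite e_sym => /(_ ewx); apply: contra => Hq.
    by apply/existsP; exists i; rewrite fx; apply/orP; left; apply/exists_inP; exists q.
  + have := virtH _ _ (fK x w _); rewrite e_sym => /(_ ewx); apply: contra => Hq.
    by apply/existsP; exists i; rewrite fx; apply/orP; right; apply/exists_inP; exists q.
  have fxF := subsetP (Qa_Fut i) _ fx; have fyF := subsetP (Qb_Fut i) _ fy.
  have xZ := FutZ _ fxF; have yZ := FutZ _ fyF.
  have xy : x != y.
    by apply: contraTneq fy => <-; apply/negP => fy; have := disjointFr (Qab i i) fx; rewrite fy.
  (* A common neighbour is big by [Rel]. As [x] comes from [P] and [y] from [Q], it then sits on a
     star centre by [PQ_big]. *)
  have := RelZ _ _ xZ yZ xy; rewrite /Rel !negb_or => /and3P[_ _ /existsPn/(_ w)].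
  rewrite ewx ewy !andbT -leqNgt => wB.
  have [fxZ hx] := fZ _ xZ; have [fyZ hy] := fZ _ yZ.
  have nS u : u \in Fut -> u \in S = false.
    by move=> uF; apply/negP => /S_notFut; rewrite uF.
  have xP : x \in P.
    have := h_Cand fxZ; rewrite /Cand hx nS // fxF; case: ifP => // /existsP[j fj].
    by have := disjointFr (Qab i j) fx; rewrite fj.
  have yQ : y \in Q.
    have := h_Cand fyZ; rewrite /Cand hy nS // fyF; case: ifP => // /negbT/existsPn/(_ i).
    by rewrite fy.
  by have /andP[wX wC] := PQ_big xP yQ ewx ewy wB; rewrite fX0.
Qed.

End Small.

End Big.

Lemma embed_step : exists f : T -> V, [/\ injective f,
  [/\ {in X0, f =1 g}, forall x, x \notin X0 -> f x \in U &
    forall x, x \notin X0 -> deg e x < D \/ deg H (f x) <= d],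
  (forall x, f x \in Fut -> deg e x < D) /\ (forall x y, f x \in Fut -> f y \in Fut -> ~~ e x y),
  forall x y, e x y -> ~~ H (f x) (f y) &
  [/\ forall i x y w, f x \in Qa i -> f y \in Qb i -> e w x -> e w y -> f w \in Cs,
    forall i x w q, f x \in Qa i -> q \in Qb i -> e w x -> ~~ H (f w) q &
    forall i x w q, f x \in Qb i -> q \in Qa i -> e w x -> ~~ H (f w) q]].
Proof.
have [g1 [g1X g1B g1I g1F]] := place_big.
have [h [hC hR]] := choose_small g1X g1B.
exact: (step_embedding g1X g1B g1I g1F hC hR).
Qed.

End Step.

(** * Splitting the big vertices into two groups *)

Section Split.

Variables (T : finType) (e : rel T) (D c top bg : nat).
Hypotheses (e_sym : symmetric e) (e_irr : irreflexive e) (e_dgn : degenerate e).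

Let Bg := [set w | D <= deg e w].

Definition attached_to (al : {set T}) : {set T} := [set x | (deg e x < D) && (nbr e x :&: Bg \subset al)].

Hypotheses (card_Bg : #|Bg| <= bg) (deg_top : forall x, deg e x <= top).
Hypothesis room : 2 * bg + 2 * c + top <= #|T|.

(* Take [al] minimal: adding one vertex to a set that is too poor brings in at most [top] vertices. *)
Lemma split_big : exists al : {set T},
  [/\ al \subset Bg, c <= #|attached_to al| & c <= #|attached_to (Bg :\: al)|].
Proof.
have all : c <= #|attached_to Bg|.
  have -> : attached_to Bg = ~: Bg by apply/setP => x; rewrite !inE subsetIr andbT -ltnNge.
  have := cardsC Bg; move: card_Bg room; lia.
have h0 : (Bg \subset Bg) && (c <= #|attached_to Bg|) by rewrite subxx.
have [al /andP[sal cal] al_min] :=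
  @arg_minnP _ Bg (fun al => (al \subset Bg) && (c <= #|attached_to al|)) (fun al : {set T} => #|al|) h0.
exists al; split=> //; have [->|/set0Pn[w wa]] := eqVneq al set0; first by rewrite setD0.
have few : #|attached_to (al :\ w)| < c.
  rewrite ltnNge; apply/negP => ge; have := al_min (al :\ w); rewrite ge (subset_trans (subD1set _ _) sal) /=.
  by move/(_ isT); rewrite [leqLHS](cardsD1 w) wa ltnn.
have le1 : #|attached_to al| <= #|attached_to (al :\ w)| + top.
  apply: leq_trans (_ : _ <= #|attached_to (al :\ w) :|: nbr e w|) _; last first.
    by apply: leq_trans (leq_card_setU _ _) _; rewrite leq_add2l deg_top.
  apply/subset_leq_card/subsetP => x; rewrite !inE => /andP[-> /subsetP sx] /=.
  have [|nxw] := boolP (e w x); [by rewrite orbT | rewrite orbF].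
  apply/subsetP => y yN; rewrite !inE sx // andbT.
  by apply: contraNneq nxw => <-; move: yN; rewrite !inE e_sym => /andP[].
(* These small vertices have big neighbours on both sides, hence at least two of them, and
   [card_two_nbrs] makes them few. *)
pose A := ~: Bg :\: (attached_to al :|: attached_to (Bg :\: al)).
have cA : #|A| <= #|Bg|.
  apply: (card_two_nbrs e_sym e_irr e_dgn).
    by rewrite disjoints_subset; apply/subsetP => x; rewrite inE => /andP[_].
  move=> x; rewrite !inE -ltnNge negb_or => /andP[/andP[+ +] xD]; rewrite xD /=.
  case/subsetPn=> u uN ua /subsetPn[v vN]; rewrite inE negb_and negbK.
  have vB : v \in Bg by case/setIP: vN.
  rewrite vB orbF => va; apply/card_gt1P; exists u, v; split=> //.
  by apply: contraNneq ua => ->.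
have : #|~: Bg| <= #|A| + (#|attached_to al| + #|attached_to (Bg :\: al)|).
  apply: leq_trans (_ : _ <= #|A :|: (attached_to al :|: attached_to (Bg :\: al))|) _.
    apply/subset_leq_card/subsetP => x xB.
    by rewrite [_ \in A :|: _]in_setU [_ \in A]in_setD xB andbT orNb.
  apply: leq_trans (leq_card_setU _ _) _; rewrite leq_add2l; exact: leq_card_setU.
have := cardsC Bg; move: card_Bg room few le1 cA; clear; lia.
Qed.

End Split.

(** * Packing *)

Lemma card_large_deg (V : finType) (H : rel V) (d N w : nat) :
  \sum_v deg H v <= N -> N < w.+1 * d -> #|[set v | d < deg H v]| <= w.
Proof.
move=> le lt; rewrite -ltnS -(@ltn_pmul2r d); last by move: lt; case: d => //; rewrite muln0.
apply: leq_ltn_trans lt; apply: leq_trans le; rewrite -sum_nat_const.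
rewrite [leqRHS](bigID [in [set v | d < deg H v]]) /=; apply: leq_trans (leq_addr _ _).
by apply: leq_sum => v; rewrite inE => /ltnW.
Qed.

Lemma exists_subset_card (T : finType) (P : {set T}) q : q <= #|P| -> exists2 P0 : {set T}, P0 \subset P & #|P0| = q.
Proof.
move=> le; exists [set x in take q (enum P)].
  by apply/subsetP => x; rewrite inE => /mem_take; rewrite mem_enum.
have u : uniq (take q (enum P)) by rewrite take_uniq ?enum_uniq.
by rewrite cardsE (card_uniqP u) size_takel // -cardE.
Qed.

Lemma card_lt_ord (t k : nat) (W : {set 'I_t}) : {in W, forall j : 'I_t, j < k} -> #|W| <= k.
Proof.
move=> Wk; rewrite cardE -(size_map val) -(size_iota 0 k); apply: uniq_leq_size.
  by rewrite (map_inj_uniq val_inj) enum_uniq.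
by move=> x /mapP[l]; rewrite mem_enum => /Wk lk ->; rewrite mem_iota.
Qed.

Lemma hosts_exist (n t b : nat) : t * (1 + 2 * b) <= n.+1 ->
  exists (c : 'I_t -> 'I_n.+1) (Ba Bb : 'I_t -> {set 'I_n.+1}),
  [/\ injective c, forall i j, c i \notin Ba j :|: Bb j,
      forall i j v, v \in Ba i :|: Bb i -> v \in Ba j :|: Bb j -> i = j,
      forall i j, [disjoint Ba i & Bb j] &
      (forall i, #|Ba i| = b) /\ (forall i, #|Bb i| = b)].
Proof.
move=> le; pose A := ('I_t * option (bool * 'I_b))%type.
have [|h [h_inj _]] := @exists_injection A 'I_n.+1 ord0 [set: A] [set: 'I_n.+1].
  by rewrite !cardsT card_prod card_option card_prod card_bool !card_ord.
have {}h_inj : injective h by move=> x y; apply: h_inj; rewrite inE.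
pose B (x : bool) (i : 'I_t) := [set h (i, Some (x, y)) | y : 'I_b].
have BP x i v : v \in B x i -> exists y, v = h (i, Some (x, y)) by case/imsetP=> y _ ->; exists y.
have BP2 i v : v \in B true i :|: B false i -> exists x y, v = h (i, Some (x, y)).
  by case/setUP=> /BP[y ->]; [exists true, y | exists false, y].
have cardB x i : #|B x i| = b by rewrite card_imset ?card_ord // => y y' /h_inj[].
exists (fun i => h (i, None)), (B true), (B false); split=> //.
- by move=> i j /h_inj[].
- by move=> i j; apply/negP => /BP2[x [y /h_inj]].
- by move=> i j v /BP2[x [y ->]] /BP2[x' [y' /h_inj[]]].
- move=> i j; rewrite -setI_eq0; apply/eqP/setP => v; rewrite [RHS]inE; apply/negP.
  by case/setIP=> /BP[y ->] /BP[y' /h_inj[]].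
Qed.

Section Assembly.

(* [m] is about [n / 100]; a vertex is big if its degree is at least [D]; [b] is the size of the reserved blocks.
   The other parameters are at most a constant times [t], except that [M] is about [m / 80]. *)
Variables (n t m M b s sS bB D : nat).

Hypotheses (D_eq : D = 40) (n_lo : 100 * m <= n) (n_hi : n < 100 * m + 100) (M_lo : 80 * M <= m) (m_lo : 1000 <= m).
Hypotheses (ineq_M : D * t <= M) (ineq_sS : 2 * n * (D * t) < sS.+1 * m) (ineq_bB : 2 * n * t < bB.+1 * M).
Hypotheses (ineq_s : (1 + D + D * D) * sS < s) (ineq_b : 2 * t + D * s <= b).
Hypotheses (ineq_z : (1 + D + D * D) * (sS + bB + t * (2 * b)) <= m).
Hypotheses (ineq_Fut : t * (2 * b) * (1 + D * t) <= m) (ineq_DFut : 2 * (D * (t * (2 * b) * (1 + D * t))) <= m).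
Hypotheses (ineq_core : D * t * (1 + (3 * t + 2 * (D * s))) <= m) (ineq_P : s + 3 * t + D * (3 * t) <= m).
Hypotheses (ineq_hosts : t * (1 + 2 * b) <= n.+1) (ineq_bare : 2 * t + t * t.+2 * (4 * t) <= m).

Section Packing.

Variable L : {set 'I_t}.
Variables (c : 'I_t -> 'I_n.+1) (Ba Bb : 'I_t -> {set 'I_n.+1}).
Local Notation V := 'I_n.+1.

Hypotheses (c_inj : injective c) (cB : forall i j, c i \notin Ba j :|: Bb j).
Hypothesis B_inj : forall i j v, v \in Ba i :|: Bb i -> v \in Ba j :|: Bb j -> i = j.
Hypothesis AB : forall i j, [disjoint Ba i & Bb j].
Hypotheses (card_Ba : forall i, #|Ba i| = b) (card_Bb : forall i, #|Bb i| = b).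

Let C := c @: L.
Let Fut k : {set V} := \bigcup_(i : 'I_t | k <= i) (Ba i :|: Bb i).

(* [H] are the edges outside [C] used by the first [k] trees, [Fut k] the hosts reserved for the other trees. *)
Definition packing_inv (k : nat) (H : rel V) : Prop :=
  [/\ symmetric H, forall u v, H u v -> u \notin C, \sum_v deg H v <= 2 * n * k,
      forall v, deg H v <= 80 * m + D * t + D * k &
      [/\ {in Fut k, forall u, deg H u <= D * k}, {in Fut k &, forall u v, ~~ H u v} &
          forall (i : 'I_t) v, k <= i -> {in Ba i & Bb i, forall q r, ~~ (H v q && H v r)}]].

(** Edges with an end in [C] are left out on purpose: their disjointness is the matter of
    [disjoint_in_C]. *)
Definition add_edges (T : finType) (e : rel T) (f : T -> V) (H : rel V) : rel V := fun u v =>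
  H u v || [&& u \notin C, v \notin C & [exists x, [exists y, [&& e x y, f x == u & f y == v]]]].

Lemma FutP k v : reflect (exists2 i : 'I_t, k <= i & v \in Ba i :|: Bb i) (v \in Fut k).
Proof. exact: bigcupP. Qed.

Lemma FutS k : Fut k.+1 \subset Fut k.
Proof. by apply/subsetP => v /FutP[i ki vi]; apply/FutP; exists i => //; apply: ltnW. Qed.

Lemma C_Fut k v : v \in C -> v \notin Fut k.
Proof.
case/imsetP=> i _ ->; apply/negP => /FutP[j _]; by rewrite (negPf (cB i j)).
Qed.

Lemma block_Fut (k : 'I_t) v : v \in Ba k :|: Bb k -> (v \in Fut k) && (v \notin Fut k.+1).
Proof.
move=> vB; apply/andP; split; first by apply/FutP; exists k.
by apply/negP => /FutP[j kj /(B_inj vB) E]; rewrite -E ltnn in kj.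
Qed.

Lemma card_Fut k : #|Fut k| <= t * (2 * b).
Proof.
apply: leq_trans (card_bigcup_leq _ _) _.
apply: (@leq_trans (\sum_(i : 'I_t) (2 * b))); last by rewrite sum_nat_const card_ord.
rewrite [leqRHS](bigID (fun i : 'I_t => k <= i)) /=; apply: leq_trans (leq_addr _ _).
apply: leq_sum => i _; apply: leq_trans (leq_card_setU _ _) _.
by rewrite card_Ba card_Bb addnn mul2n.
Qed.

(** * Preserving the packing invariant *)

Section AddEdges.

Variables (k : 'I_t) (T : finType) (e : rel T) (f : T -> V) (H : rel V).
Hypotheses (e_sym : symmetric e) (e_irr : irreflexive e) (e_dgn : degenerate e).
Hypotheses (f_inj : injective f) (card_T : #|T| <= n) (invH : packing_inv k H).

Lemma add_edgesP u v : add_edges e f H u v ->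
  H u v \/ [/\ u \notin C, v \notin C & exists x y, [/\ e x y, f x = u & f y = v]].
Proof.
case/orP=> [|/and3P[uC vC /existsP[x /existsP[y /and3P[exy /eqP fx /eqP fy]]]]]; first by left.
by right; split=> //; exists x, y.
Qed.

Lemma deg_add v : deg (add_edges e f H) v <= deg H v + \sum_(x | (f x == v) && (f x \notin C)) deg e x.
Proof.
have [/existsP[x /andP[/eqP fx xC]]|no] := boolP [exists x, (f x == v) && (f x \notin C)].
  rewrite (bigD1 x) /=; last by rewrite fx -fx xC eqxx.
  rewrite addnA; apply: leq_trans (leq_addr _ _).
  rewrite /deg -[#|nbr e x|](card_imset _ f_inj); apply: leq_trans (leq_card_setU _ _).
  apply/subset_leq_card/subsetP => w; rewrite !inE => /add_edgesP[->//|[_ _ [x' [y [exy fx' <-]]]]].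
  by rewrite imset_f ?orbT // inE -(f_inj (etrans fx' (esym fx))).
apply: leq_trans (leq_addr _ _); apply/subset_leq_card/subsetP => w.
rewrite !inE => /add_edgesP[//|[vC _ [x [y [_ fx _]]]]].
by move/existsPn/(_ x): no; rewrite fx eqxx vC.
Qed.

Lemma sum_one v : \sum_(x | (f x == v) && (f x \notin C)) deg e x =
  if [pick x | (f x == v) && (f x \notin C)] is Some x then deg e x else 0.
Proof.
case: pickP => [x /andP[/eqP fx xC]|no]; last by rewrite big_pred0.
rewrite (bigD1 x) /=; last by rewrite fx -fx xC eqxx.
rewrite big1 ?addn0 // => y /andP[/andP[/eqP fy _]]; by rewrite (f_inj (etrans fy (esym fx))) eqxx.
Qed.

Hypothesis deg_f : forall x, f x \notin C -> deg e x < D \/ deg H (f x) <= D * t /\ deg e x <= 80 * m.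
Hypothesis small_f : forall x, f x \in Fut k.+1 -> deg e x < D.
Hypothesis indep_f : forall x y, f x \in Fut k.+1 -> f y \in Fut k.+1 -> ~~ e x y.
Hypothesis pair_f : forall (i : 'I_t) x y w, k < i -> f x \in Ba i -> f y \in Bb i -> e w x -> e w y -> f w \in C.
Hypothesis pair_a : forall (i : 'I_t) x w q, k < i -> f x \in Ba i -> q \in Bb i -> e w x -> ~~ H (f w) q.
Hypothesis pair_b : forall (i : 'I_t) x w q, k < i -> f x \in Bb i -> q \in Ba i -> e w x -> ~~ H (f w) q.

Lemma packing_inv_step : packing_inv k.+1 (add_edges e f H).
Proof.
have [H_sym H_C H_sum H_deg [Fd Fi Fp]] := invH.
(* A host outside [C] that receives a big vertex had degree at most [D * t] before, so large degrees
   do not accumulate; a small vertex adds less than [D]. *)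
have bound v : deg (add_edges e f H) v <= deg H v + D \/
    deg (add_edges e f H) v <= D * t + 80 * m.
  have := deg_add v; rewrite sum_one; case: pickP => [x /andP[/eqP <- xC]|_] le.
    case: (deg_f xC) => [lt|[h1 h2]]; [left | right].
      by apply: leq_trans le _; rewrite leq_add2l ltnW.
    by apply: leq_trans le _; apply: leq_add.
  by left; apply: leq_trans le _; rewrite addn0 leq_addr.
split; [| | | |split].
- move=> u v; rewrite /add_edges H_sym; congr (_ || _).
  rewrite andbCA; congr [&& _, _ & _].
  apply/existsP/existsP => -[x /existsP[y /and3P[exy fx fy]]];
    by exists y; apply/existsP; exists x; rewrite e_sym exy fx fy.
- by move=> u v /add_edgesP[/H_C|[]].
- apply: (@leq_trans (\sum_v (deg H v + \sum_(x | (f x == v) && (f x \notin C)) deg e x))).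
    by apply: leq_sum => v _; apply: deg_add.
  rewrite big_split /= mulnS addnC; apply: leq_add => //.
  apply: (@leq_trans (\sum_v \sum_(x | f x == v) deg e x)).
    apply: leq_sum => v _; rewrite [leqRHS](bigID (fun x => f x \notin C)) /=; exact: leq_addr.
  have -> : \sum_v \sum_(x | f x == v) deg e x = \sum_x deg e x by rewrite [RHS](partition_big f xpredT).
  apply: leq_trans (sum_deg e_sym e_irr e_dgn) _.
  by rewrite -mul2n leq_mul2l /=; apply: leq_trans (leq_pred _) card_T.
- move=> v; case: (bound v) => le; apply: leq_trans le _.
    by rewrite mulnS addnCA addnC leq_add2l H_deg.
  by rewrite addnC leq_addr.
- move=> u uF; have uF' := subsetP (FutS k) _ uF.
  have := deg_add u; rewrite sum_one; case: pickP => [x /andP[/eqP fx _]|_] le; apply: leq_trans le _.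
    by rewrite mulnS addnC; apply: leq_add; [apply/ltnW/small_f; rewrite fx | apply: Fd].
  by rewrite addn0 mulnS; apply: leq_trans (leq_addl _ _); apply: Fd.
- move=> u v uF vF; apply/negP => /add_edgesP[|[_ _ [x [y [exy fx fy]]]]].
    by rewrite (negPf (Fi _ _ _ _)) // (subsetP (FutS k)).
  by have := @indep_f x y; rewrite fx fy uF vF exy => /(_ isT isT).
- move=> i v ki q r qA rB; apply/negP => /andP[].
  case/add_edgesP=> [Hq|[vC _ [w [x [ewx fw fx]]]]]; case/add_edgesP=> [Hr|[_ _ [w' [y [ewy fw' fy]]]]].
  + by have := Fp i v (ltnW ki) q r qA rB; rewrite Hq Hr.
  + by have := @pair_b i y w' q ki; rewrite fy fw' Hq => /(_ rB qA ewy).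
  + by have := @pair_a i x w r ki; rewrite fx fw Hr => /(_ qA rB ewx).
  + have E : w' = w by apply: f_inj; rewrite fw.
    have := @pair_f i x y w ki; rewrite fx fy fw => /(_ qA rB ewx); rewrite -E => /(_ ewy).
    by rewrite (negPf vC).
Qed.

End AddEdges.

Lemma card_big_deg (T : finType) (e : rel T) :
  is_tree e -> #|T| <= n -> #|[set w | D <= deg e w]| <= 5 * m + 5.
Proof.
move=> tr le; have [[e_sym e_irr] _ _ _] := tr.
have h : {in [set w | D <= deg e w], forall w, D <= deg e w} by move=> w; rewrite inE.
have := card_deg_ge e_sym e_irr (tree_degenerate tr) h.
move: n_hi le; rewrite D_eq; clear; lia.
Qed.

Lemma embed_tree (k : 'I_t) (T : finType) (e : rel T) (H : rel V) (X0 al be P Q P0 Q0 : {set T})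
    (g : T -> V) (U : {set V}) :
  is_tree e -> #|T| = n - k -> packing_inv k H -> {in X0 &, injective g} ->
  {in X0, forall x, g x \in C \/ g x \in Ba k :|: Bb k} ->
  al \subset X0 -> be \subset X0 -> {in al, forall x, g x \in Ba k} -> {in be, forall x, g x \in Bb k} ->
  {in X0, forall x, g x \notin U} -> {in U, forall u, u \notin C} -> #|~: X0| <= #|U| ->
  #|X0| <= 3 * t + 2 * (D * s) ->
  (forall x, ~~ ((x \in X0) && (g x \in C)) -> deg e x <= 80 * m) ->
  {in P :|: Q, forall x, (x \notin X0) && (deg e x < D)} ->
  (forall w, {in P & Q, forall x y, e w x -> e w y -> D <= deg e w -> (w \in X0) && (g w \in C)}) ->
  P0 \subset P -> Q0 \subset Q ->
  {in P0, forall x w, e x w -> (D <= deg e w) || (w \in X0) -> (w \in al) || (w \in X0) && (g w \in C)} ->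
  {in Q0, forall x w, e x w -> (D <= deg e w) || (w \in X0) -> (w \in be) || (w \in X0) && (g w \in C)} ->
  s <= #|P0| -> s <= #|Q0| -> 3 * m <= #|P| -> 3 * m <= #|Q| ->
  exists f : T -> V, [/\ injective f, {in X0, f =1 g}, forall x, x \notin X0 -> f x \in U,
    forall x y, e x y -> ~~ H (f x) (f y) & packing_inv k.+1 (add_edges e f H)].
Proof.
move=> tr cT invH g_inj g_host alX beX g_al g_be gU UC cU cX deg_top small PQb P0P Q0Q P0b Q0b sP0 sQ0 mP mQ.
have [[e_sym e_irr] /card_gt0P[t0 _] _ _] := tr.
have dgn := tree_degenerate tr.
have [H_sym H_C H_sum H_deg [Fd Fi Fp]] := invH.
have kt := ltn_ord k.
have leT : #|T| <= n by rewrite cT leq_subr.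
have g_blk x : x \in X0 -> g x \notin C -> (g x \in Fut k) && (g x \notin Fut k.+1).
  by move=> xX xC; case: (g_host x xX) => [xC'|/block_Fut//]; rewrite xC' in xC.
have nHC u v : u \in C -> ~~ H u v by move=> uC; apply: contraTN uC; apply: H_C.
have dC u : u \in C -> deg H u = 0.
  by move=> uC; apply: eq_card0 => v; rewrite in_nbr (negPf (nHC _ _ uC)).
have dkt : D * k <= D * t by rewrite leq_mul2l ltnW ?orbT.
pose Qa (i : 'I_t) := if k < i then Ba i else set0.
pose Qb (i : 'I_t) := if k < i then Bb i else set0.
have cF := card_Fut k.+1.
have sum_le : \sum_v deg H v <= 2 * n * t.
  by apply: leq_trans H_sum _; rewrite leq_mul2l ltnW ?orbT.
set F := #|Fut k.+1| in cF.
have F1 : F * (1 + D * t) <= m by apply: leq_trans ineq_Fut; rewrite leq_mul2r cF orbT.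
have F2 : 2 * (D * (F * (1 + D * t))) <= m.
  by apply: leq_trans ineq_DFut; rewrite !leq_mul2l leq_mul2r cF !orbT.
have F3 : (1 + D + D * D) * (sS + bB + F) <= m.
  by apply: leq_trans ineq_z; rewrite leq_mul2l leq_add2l cF orbT.
have F4 : sS + bB + F <= m by apply: leq_trans F3; rewrite leq_pmull.
have X1 : D * t * (1 + #|X0|) <= m by apply: leq_trans ineq_core; rewrite leq_mul2l leq_add2l cX orbT.
have X2 : #|X0| <= m.
  apply: leq_trans X1; apply: leq_trans (leq_addl 1 _) _; rewrite leq_pmull // D_eq muln_gt0 /=.
  exact: leq_ltn_trans (leq0n k) kt.
have tm : t <= m by move: ineq_P; clear; lia.
have U1 : n <= #|U| + 2 * m.
  by have := cardsC X0; move: cU X2 tm cT kt; clear; lia.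
(* Both bounds [5 * m + 5] are about [n / 20]: the tree has degree sum at most [2 n] and threshold
   [D = 40], and [H] has degree sum at most [2 n t] and threshold [D * t]. *)
have := @embed_step T V 'I_t t0 e H X0 al be P Q P0 Q0 g U C (Fut k.+1) Qa Qb
  D (D * t) M m (80 * m + D * t + D * t) (5 * m + 5) (5 * m + 5) sS bB.
case=> //.
- move=> x xX; have [xC|xC] := boolP (g x \in C); first exact: C_Fut.
  by case/andP: (g_blk x xX xC).
- move=> x y xX yX exy; have [xC|xC] := boolP (g x \in C); first exact: nHC.
  have [yC|yC] := boolP (g y \in C); first by rewrite H_sym; exact: nHC.
  by apply: Fi; [case/andP: (g_blk x xX xC) | case/andP: (g_blk y yX yC)].
- move=> x xX; have [xC|xC] := boolP (g x \in C); first by rewrite dC.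
  by have /andP[xF _] := g_blk x xX xC; apply: leq_trans (Fd _ xF) dkt.
- by move=> u uF; apply: leq_trans (Fd _ (subsetP (FutS k) _ uF)) dkt.
- by move=> u; apply: leq_trans (H_deg u) _; rewrite leq_add2l.
- move=> x u xX uF; have [xC|xC] := boolP (g x \in C); first exact: nHC.
  by have /andP[xF _] := g_blk x xX xC; apply: Fi => //; apply: (subsetP (FutS k)).
- by move=> u v uF vF; apply: Fi; apply: (subsetP (FutS k)).
- move=> i; rewrite /Qa; case: ifP => ki; last exact: sub0set.
  by apply/subsetP => v vB; apply/FutP; exists i; rewrite // inE vB.
- move=> i; rewrite /Qb; case: ifP => ki; last exact: sub0set.
  by apply/subsetP => v vB; apply/FutP; exists i; rewrite // inE vB orbT.
- move=> i j; rewrite /Qa /Qb; case: ifP => _; last by rewrite disjoints_subset sub0set.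
  by case: ifP => _; rewrite ?AB // disjoint_sym disjoints_subset sub0set.
- by move=> v x y xa yb; apply: (Fp k) => //; [apply: g_al | apply: g_be].
- exact: card_big_deg tr leT.
- apply: card_large_deg sum_le _; move: n_hi kt; rewrite D_eq; clear; nia.
- exact: card_large_deg sum_le ineq_bB.
- by rewrite -/F; move: X1 F1 U1 n_lo m_lo; rewrite mulnDr muln1; clear; lia.
- apply: leq_ltn_trans ineq_sS; rewrite leq_mul2r; apply/orP; right; rewrite -mul2n leq_mul2l; exact: leT.
- exact: leq_trans ineq_s sP0.
- exact: leq_trans ineq_s sQ0.
- apply: leq_trans mP; rewrite -/F; move: F3 m_lo; clear; lia.
- apply: leq_trans mQ; rewrite -/F; move: F3 m_lo; clear; lia.
(* The main terms are about [80 m] from [hh] and [5 m] from [bg], against at least [98 m] hosts in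
   [U]. *)
- have DM : 2 * (D * M) <= m by move: M_lo; rewrite D_eq; clear; lia.
  have Dt : 2 * (D * t) <= m by move: M_lo ineq_M; clear; lia.
  rewrite -/F mulnDr mulnDr; move: DM Dt F2 F4 U1 n_lo m_lo; rewrite D_eq; clear; lia.
move=> f [f_inj [fX fU fdeg] [fsm find] favoid [p1 p2 p3]]; exists f; split=> //.
apply: packing_inv_step => //.
- move=> x xC; have dx : deg e x <= 80 * m.
    by apply: deg_top; apply: contra xC => /andP[xX gC]; rewrite fX.
  have [xX|xX] := boolP (x \in X0); last by case: (fdeg x xX); [left | right].
  right; split=> //; rewrite fX //; rewrite fX // in xC.
  by have /andP[xF _] := g_blk x xX xC; apply: leq_trans (Fd _ xF) dkt.
- move=> i x y w ki fx fy; apply: (p1 i); rewrite /Qa /Qb ki //.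
- move=> i x w q ki fx qB; apply: (p2 i x); rewrite /Qa /Qb ki //.
- move=> i x w q ki fx qB; apply: (p3 i x); rewrite /Qa /Qb ki //.
Qed.

(** The later centres outside [A] are filled with leaves at [v], so every tree edge at a centre has
    an end on [c k]. The remaining leaves at [v] serve as [P], [Q], [P0] and [Q0] at once: their
    only neighbour sits on a centre, where [H] has no edges, and [al] and [be] can be empty. *)
Lemma embed_star (k : 'I_t) (T : finType) (e : rel T) (H : rel V) (A : {set V}) (v : T) :
  is_tree e -> #|T| = n - k -> packing_inv k H -> k \in L -> 80 * m <= deg e v ->
  #|A| <= k + 1 -> c k \notin A -> (forall l : 'I_t, l \in L -> l < k -> c l \in A) ->
  exists f : T -> V, [/\ injective f, forall x, f x \notin A,
    forall x y, e x y -> f x \in C -> f x = c k \/ f y = c k,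
    forall x y, e x y -> ~~ H (f x) (f y) & packing_inv k.+1 (add_edges e f H)].
Proof.
move=> tr cT invH kL vdeg cA ckA clA.
have [[e_sym e_irr] _ _ _] := tr; have dgn := tree_degenerate tr.
have kt := ltn_ord k.
have tm : 4 * t <= m by move: ineq_M M_lo; rewrite D_eq; clear; lia.
pose Lf := [set x in nbr e v | deg e x == 1].
have deg_gt0 : forall x, 0 < deg e x.
  by apply: tree_deg_gt0 => //; rewrite cT; move: kt tm n_lo m_lo; clear; lia.
have cLf : 59 * m <= #|Lf|.
  have := card_leaf_nbrs e_sym e_irr dgn deg_gt0 v; rewrite -/Lf cT.
  move: vdeg n_hi m_lo; clear; lia.
have LfP x w : x \in Lf -> e x w -> w = v.
  rewrite !inE => /andP[evx /cards1P[y yE]] exw.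
  have : w \in nbr e x by rewrite inE.
  have : v \in nbr e x by rewrite inE e_sym.
  by rewrite yE !inE => /eqP-> /eqP->.
have vLf : v \notin Lf by rewrite !inE e_irr.
have [|xi [xi_inj xiL]] := @exists_injection 'I_t _ v [set: 'I_t] Lf.
  by rewrite cardsT card_ord; move: cLf tm; clear; lia.
have {}xi_inj : injective xi by move=> i j; apply: xi_inj; rewrite inE.
have {}xiL i : xi i \in Lf by apply: xiL; rewrite inE.
pose Vs := [set i in L | (k < i) && (c i \notin A)].
pose X0 := v |: xi @: Vs.
pose g x := if [pick i | xi i == x] is Some i then c i else c k.
have gxi i : g (xi i) = c i.
  by rewrite /g; case: pickP => [j /eqP/xi_inj->//|/(_ i)]; rewrite eqxx.
have gv : g v = c k.
  by rewrite /g; case: pickP => [j /eqP E|//]; have := xiL j; rewrite E (negPf vLf).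
have gX0 x : x \in X0 -> exists2 i, (i \in L) && (c i \notin A) & g x = c i.
  case/setU1P=> [->|/imsetP[i]]; first by exists k; rewrite ?kL.
  by rewrite inE => /and3P[iL _ iA] ->; exists i; rewrite ?iL.
have cC i : i \in L -> c i \in C by move=> iL; apply: imset_f.
pose U := ~: (A :|: C).
have cX0 : #|X0| = #|Vs|.+1.
  rewrite cardsU1 card_imset // (_ : v \notin _) //.
  by apply/imsetP => -[i _ E]; have := xiL i; rewrite -E (negPf vLf).
have cVs : #|Vs| <= t by apply: leq_trans (max_card _) _; rewrite card_ord.
(* Nothing is to spare here: [n + 1] hosts minus [k + 1] for [A] and [#|Vs| + 1] for the remaining
   centres leave exactly [n - k - #|X0|]. *)
have cU : #|~: X0| <= #|U|.
  have : #|A :|: C| <= #|A| + #|Vs|.+1.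
    apply: (@leq_trans #|A :|: (c k |: c @: Vs)|).
      apply/subset_leq_card/subsetP => u; rewrite !inE => /orP[->//|/imsetP[i iL ->]].
      have [//|iA] := boolP (c i \in A); rewrite (inj_eq c_inj) /=.
      case: (ltngtP i k) => [ik|ki|/val_inj->].
      - by rewrite clA in iA.
      - by apply/orP; right; apply: imset_f; rewrite inE iL ki.
      - by rewrite eqxx.
    apply: leq_trans (leq_card_setU _ _) _; rewrite leq_add2l.
    apply: leq_trans (leq_card_setU _ _) _; rewrite cards1 add1n ltnS; exact: leq_imset_card.
  have := cardsC X0; have := cardsC (A :|: C); rewrite card_ord -/U cX0 cT; move: cA kt; clear; lia.
have PX : 3 * m <= #|Lf :\: X0|.
  have := cardsID X0 Lf; have := subset_leq_card (subsetIr Lf X0); rewrite cX0.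
  move: cVs tm cLf m_lo; clear; lia.
have PS : s <= #|Lf :\: X0| by apply: leq_trans PX; move: ineq_P; clear; lia.
have v_only x w : x \in Lf :\: X0 -> e w x -> (w \in X0) && (g w \in C).
  case/setDP=> xL _; rewrite e_sym => /(LfP _ _ xL)->; by rewrite setU11 gv cC.
have deg_v x : x != v -> deg e x <= 80 * m.
  move=> xv; have := deg_pair_le e_sym e_irr dgn deg_gt0 xv; rewrite cT.
  move: vdeg n_hi m_lo; clear; lia.
have gX0C x : x \in X0 -> g x \in C by case/gX0=> i /andP[/cC iC _] ->.
have := @embed_tree k T e H X0 set0 set0 (Lf :\: X0) (Lf :\: X0) (Lf :\: X0) (Lf :\: X0) g U tr cT invH.
case=> //; try exact: sub0set; try by move=> x; rewrite inE.
- have kv i : i \in Vs -> c k != c i.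
    by rewrite inE (inj_eq c_inj) => /and3P[_ ki _]; apply: contraTneq ki => ->; rewrite ltnn.
  move=> x y /setU1P[->|/imsetP[i iV ->]] /setU1P[->|/imsetP[j jV ->]] //; rewrite ?gv ?gxi.
  + by move=> E; have := kv _ jV; rewrite E eqxx.
  + by move=> E; have := kv _ iV; rewrite E eqxx.
  + by move/c_inj->.
- by move=> x /gX0C; left.
- by move=> x /gX0C xC; rewrite !inE xC orbT.
- by move=> u; rewrite !inE negb_or => /andP[].
- by rewrite cX0; move: cVs kt; clear; lia.
- move=> x xX; apply: deg_v; apply: contraNneq xX => ->.
  by rewrite setU11 gv cC.
- by move=> x; rewrite setUid => /setDP[+ ->]; rewrite !inE D_eq => /andP[_ /eqP->].
- by move=> w x y xP _ ewx _ _; apply: v_only ewx.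
- by move=> x xP w exw _; rewrite (v_only x) ?orbT // e_sym.
- by move=> x xP w exw _; rewrite (v_only x) ?orbT // e_sym.
move=> f [f_inj fX fU favoid invf]; exists f; split=> //.
- move=> x; have [xX|xX] := boolP (x \in X0).
    rewrite fX //; move: xX => /setU1P[->|/imsetP[i iV ->]]; first by rewrite gv.
    by rewrite gxi; move: iV; rewrite inE => /and3P[].
  by have := fU x xX; rewrite !inE negb_or => /andP[].
- move=> x y exy fxC; have [xX|xX] := boolP (x \in X0); last first.
    by have := fU x xX; rewrite !inE fxC orbT.
  have vX : v \in X0 by rewrite setU11.
  move: xX => /setU1P[xv|/imsetP[i iV xE]]; first by left; rewrite xv fX.
  by right; rewrite (LfP x y) ?fX // xE.
Qed.

(** The neighbours [Y] of the visiting vertices go to the tree's own blocks, so that edges leaving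
    the centres differ from tree to tree. The big neighbours [a0] of [P0] and [b0] of [Q0] go to
    [Ba k] and [Bb k], which by the invariant no host sees both. *)
Lemma embed_other (k : 'I_t) (T : finType) (e : rel T) (H : rel V) (Vs : {set 'I_t})
    (prd : 'I_t -> option 'I_t) (xi : 'I_t -> T) :
  is_tree e -> #|T| = n - k -> packing_inv k H -> attachment e Vs prd xi -> Vs \subset L ->
  #|L| <= k + 1 + #|Vs| -> (forall x, deg e x <= 80 * m) ->
  exists f : T -> V, [/\ injective f,
    (forall x i, i \in L -> f x = c i -> i \in Vs /\ x = xi i) /\ {in Vs, forall i, f (xi i) = c i},
    forall x y, e x y -> f x \in C -> f y \notin C -> f y \in Ba k :|: Bb k,
    forall x y, e x y -> ~~ H (f x) (f y) & packing_inv k.+1 (add_edges e f H)].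
Proof.
move=> tr cT invH [xi_inj _ _ xi2] VL cL deg_top.
have [[e_sym e_irr] _ _ _] := tr; have dgn := tree_degenerate tr.
have kt := ltn_ord k.
have leT : #|T| <= n by rewrite cT leq_subr.
have tm : 4 * t <= m by move: ineq_M M_lo; rewrite D_eq; clear; lia.
have cVs : #|Vs| <= t by apply: leq_trans (max_card _) _; rewrite card_ord.
pose Bg := [set w | D <= deg e w].
have [|al [alB cal cbe]] := @split_big T e D (4 * m) (80 * m) (5 * m + 5) e_sym e_irr dgn
  (card_big_deg tr leT) deg_top.
  by rewrite cT; move: tm n_lo m_lo kt; clear; lia.
rewrite -/Bg in alB cbe.
pose XI := xi @: Vs.
pose Y := (\bigcup_(i in Vs) nbr e (xi i)) :\: XI.
have cXI : #|XI| = #|Vs| by apply: card_in_imset.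
have cY : #|Y| <= 2 * t.
  apply: leq_trans (subset_leq_card (subsetDl _ _)) _; apply: leq_trans (card_bigcup_leq _ _) _.
  apply: (@leq_trans (\sum_(i in Vs) 2)); first by apply: leq_sum => i _; apply: xi2.
  by rewrite sum_nat_const mulnC leq_mul2l.
(* Once [NS] is removed from [P] and [Q], their vertices have only big neighbours in [X0]. *)
pose NS := \bigcup_(w in [set w in XI :|: Y | deg e w < D]) nbr e w.
have cXY : #|XI :|: Y| <= 3 * t.
  by apply: leq_trans (leq_card_setU _ _) _; move: cY cXI cVs; clear; lia.
have cNS : #|NS| <= D * (3 * t).
  apply: leq_trans (card_bigcup_leq _ _) _.
  apply: (@leq_trans (\sum_(w in [set w in XI :|: Y | deg e w < D]) D)).
    by apply: leq_sum => w; rewrite inE => /andP[_ /ltnW].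
  rewrite sum_nat_const mulnC leq_mul2l; apply/orP; right; apply: leq_trans cXY.
  by apply/subset_leq_card/subsetP => w; rewrite inE => /andP[].
have trim (W : {set T}) : 4 * m <= #|W| -> 3 * m <= #|W :\: ((XI :|: Y) :|: NS)|.
  move=> cW; have := cardsID ((XI :|: Y) :|: NS) W.
  have := subset_leq_card (subsetIr W ((XI :|: Y) :|: NS)).
  have : #|(XI :|: Y) :|: NS| <= #|XI :|: Y| + #|NS| := leq_card_setU _ _; move: cXY cNS cW ineq_P; clear; lia.
set P := attached_to e D al :\: ((XI :|: Y) :|: NS).
set Q := attached_to e D (Bg :\: al) :\: ((XI :|: Y) :|: NS).
have cP : 3 * m <= #|P| by apply: trim.
have cQ : 3 * m <= #|Q| by apply: trim.
have sm : s <= 3 * m by move: ineq_P; clear; lia.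
have [P0 P0P cP0] := exists_subset_card (leq_trans sm cP).
have [Q0 Q0Q cQ0] := exists_subset_card (leq_trans sm cQ).
pose a0 := Bg :&: \bigcup_(x in P0) nbr e x.
pose b0 := Bg :&: \bigcup_(x in Q0) nbr e x.
have small_at W x : x \in attached_to e D W -> deg e x < D by rewrite inE => /andP[].
have at_big W x w : x \in attached_to e D W -> w \in Bg -> e x w -> w \in W.
  by rewrite inE => /andP[_ /subsetP sW] wB exw; apply: sW; rewrite in_setI in_nbr exw.
have card0 (W : {set T}) : #|W| = s -> {in W, forall x, deg e x < D} ->
    #|Bg :&: \bigcup_(x in W) nbr e x| <= D * s.
  move=> <- WD; apply: leq_trans (subset_leq_card (subsetIr _ _)) _.
  apply: leq_trans (card_bigcup_leq _ _) _; rewrite mulnC -sum_nat_const.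
  by apply: leq_sum => x /WD/ltnW.
have P0s x : x \in P0 -> x \in attached_to e D al by move/(subsetP P0P); case/setDP.
have Q0s x : x \in Q0 -> x \in attached_to e D (Bg :\: al) by move/(subsetP Q0Q); case/setDP.
have ca0 : #|a0| <= D * s by apply: card0 => // x /P0s/small_at.
have cb0 : #|b0| <= D * s by apply: card0 => // x /Q0s/small_at.
have a0al w : w \in a0 -> w \in al.
  by case/setIP=> wB /bigcupP[x /P0s xP]; rewrite in_nbr; apply: at_big.
have b0al w : w \in b0 -> w \notin al.
  case/setIP=> wB /bigcupP[x /Q0s xQ]; rewrite in_nbr => exw.
  by have /setDP[] := at_big _ _ _ xQ wB exw.
have a0B w : w \in a0 -> D <= deg e w by case/setIP; rewrite inE.
have b0B w : w \in b0 -> D <= deg e w by case/setIP; rewrite inE.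
have XIs w : w \in XI -> deg e w < D.
  by case/imsetP=> i _ ->; apply: leq_ltn_trans (xi2 i) _; rewrite D_eq.
have a0b0 w : w \in a0 -> w \notin b0.
  by move=> wa; apply/negP => /b0al; rewrite (a0al _ wa).
pose X0 := XI :|: (Y :|: a0 :|: b0).
have [|ga [ga_inj gaB]] := @exists_injection T V (c k) (Y :|: a0) (Ba k).
  rewrite card_Ba; apply: leq_trans ineq_b; apply: leq_trans (leq_card_setU _ _) _.
  exact: leq_add.
have [|gb [gb_inj gbB]] := @exists_injection T V (c k) b0 (Bb k).
  by rewrite card_Bb; apply: leq_trans cb0 _; apply: leq_trans ineq_b; apply: leq_addl.
pose gx x := if [pick i in Vs | xi i == x] is Some i then c i else c k.
have gxi i : i \in Vs -> gx (xi i) = c i.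
  move=> iV; rewrite /gx; case: pickP => [j /andP[jV /eqP/xi_inj->//]|/(_ i)].
  by rewrite iV eqxx.
pose g x := if x \in XI then gx x else if x \in b0 then gb x else ga x.
have gXI i : i \in Vs -> g (xi i) = c i.
  by move=> iV; rewrite /g imset_f // gxi.
have cC i : i \in L -> c i \in C by move=> iL; apply: imset_f.
have XIC x : x \in XI -> g x \in C.
  by case/imsetP=> i iV ->; rewrite gXI // cC // (subsetP VL).
have a0XI x : x \in a0 -> x \notin XI.
  by move=> xa; apply/negP => /XIs; rewrite ltnNge a0B.
have b0XI x : x \in b0 -> x \notin XI.
  by move=> xb; apply/negP => /XIs; rewrite ltnNge b0B.
have gb0 x : x \in b0 -> g x \in Bb k.
  by move=> xb; rewrite /g (negPf (b0XI _ xb)) xb gbB.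
have gYa x : x \in X0 -> x \notin XI -> x \notin b0 -> (g x = ga x) * (x \in Y :|: a0).
  move=> xX xI xb; rewrite /g (negPf xI) (negPf xb); split=> //.
  by move: xX; rewrite /X0 in_setU (negPf xI) in_setU (negPf xb) orbF.
have blk x : x \in X0 -> x \notin XI -> g x \in Ba k :|: Bb k.
  move=> xX xI; have [xb|xb] := boolP (x \in b0); first by rewrite in_setU gb0 ?orbT.
  by have [-> xY] := gYa x xX xI xb; rewrite in_setU gaB.
have blkC u : u \in Ba k :|: Bb k -> u \notin C.
  by move=> uB; apply/imsetP => -[i _ E]; have := cB i k; rewrite -E uB.
pose U := ~: (C :|: g @: X0).
have g_inj : {in X0 &, injective g}.
  move=> x y xX yX; have [xI|xI] := boolP (x \in XI); have [yI|yI] := boolP (y \in XI).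
  - case/imsetP: xI => i iV ->; case/imsetP: yI => j jV ->.
    by rewrite !gXI // => /c_inj->.
  - by move=> E; have := blkC _ (blk y yX yI); rewrite -E XIC.
  - by move=> E; have := blkC _ (blk x xX xI); rewrite E XIC.
  have [xb|xb] := boolP (x \in b0); have [yb|yb] := boolP (y \in b0).
  - by rewrite /g (negPf xI) (negPf yI) xb yb; apply: gb_inj.
  - have [-> yY] := gYa y yX yI yb; move=> E; have := disjointFr (AB k k) (gaB _ yY).
    by rewrite -E gb0.
  - have [-> xY] := gYa x xX xI xb; move=> E; have := disjointFr (AB k k) (gaB _ xY).
    by rewrite E gb0.
  - have [-> xY] := gYa x xX xI xb; have [-> yY] := gYa y yX yI yb; exact: ga_inj.
have XIX0 : XI \subset X0 by apply: subsetUl.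
have cX0D : #|X0| = #|Vs| + #|X0 :\: XI|.
  by rewrite -(cardsID XI X0) (setIidPr XIX0) cXI.
have cX0 : #|X0| <= 3 * t + 2 * (D * s).
  rewrite cX0D; have : #|X0 :\: XI| <= #|Y| + #|a0| + #|b0|.
    apply: (@leq_trans #|Y :|: a0 :|: b0|).
      by apply/subset_leq_card/subsetP => x /setDP[+ xI]; rewrite /X0 in_setU (negPf xI).
    apply: leq_trans (leq_card_setU _ _) _; rewrite leq_add2r; exact: leq_card_setU.
  move: cVs cY ca0 cb0; clear; lia.
have cU : #|~: X0| <= #|U|.
  have : #|C :|: g @: X0| <= #|L| + #|X0 :\: XI|.
    apply: (@leq_trans #|C :|: g @: (X0 :\: XI)|).
      apply/subset_leq_card/subsetP => u; rewrite !in_setU => /orP[->//|/imsetP[x xX ->]].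
      have [xI|xI] := boolP (x \in XI); first by rewrite XIC.
      by rewrite imset_f ?orbT // in_setD xI.
    apply: leq_trans (leq_card_setU _ _) _; apply: leq_add; exact: leq_imset_card.
  have := cardsC X0; have := cardsC (C :|: g @: X0); rewrite card_ord -/U cX0D cT.
  move: cL kt; clear; lia.
have UC u : u \in U -> u \notin C by rewrite in_setC in_setU negb_or => /andP[].
have notX0 x : x \notin XI :|: Y -> deg e x < D -> x \notin X0.
  rewrite in_setU negb_or => /andP[xI xY] xD; rewrite in_setU (negPf xI) /= !in_setU (negPf xY) /=.
  by rewrite negb_or; apply/andP; split; apply: contraTN xD; rewrite -leqNgt; [apply: a0B | apply: b0B].
have PQprop x : x \in P :|: Q -> [&& x \notin XI :|: Y, x \notin NS & deg e x < D].
  case/setUP; case/setDP=> /small_at xD; rewrite in_setU negb_or => /andP[-> ->];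
  by rewrite xD.
have smallX0 x w : x \in P :|: Q -> e x w -> w \in X0 -> ~~ (D <= deg e w) -> False.
  move=> xPQ exw wX; rewrite -ltnNge => wD; have /and3P[_ + _] := PQprop x xPQ; case/negP.
  apply/bigcupP; exists w; last by rewrite in_nbr e_sym.
  rewrite inE wD andbT; apply: contraLR wX => wI; exact: notX0.
have := @embed_tree k T e H X0 a0 b0 P Q P0 Q0 g U tr cT invH g_inj.
case=> //; rewrite ?cP0 ?cQ0 //.
- move=> x xX; have [xI|xI] := boolP (x \in XI); [left; exact: XIC | right; exact: blk].
- by apply/subsetP => x xa; rewrite !in_setU xa !orbT.
- by apply/subsetP => x xb; rewrite !in_setU xb !orbT.
- move=> x xa; have [|->] := gYa x _ (a0XI x xa) (a0b0 x xa); first by rewrite !in_setU xa !orbT.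
  by move=> xY; apply: gaB.
- by move=> x xX; rewrite in_setC in_setU imset_f ?orbT.
- move=> x xPQ; have /and3P[h1 _ h2] := PQprop x xPQ; by rewrite notX0.
- move=> w x y /setDP[xP _] /setDP[yQ _]; rewrite e_sym => exw; rewrite e_sym => eyw wB.
  have wBg : w \in Bg by rewrite inE.
  have /setDP[_] := at_big _ _ _ yQ wBg eyw; by rewrite (at_big _ _ _ xP wBg exw).
- move=> x xP w exw wB; apply/orP; left.
  have [wD|wD] := boolP (D <= deg e w).
    by rewrite in_setI inE wD; apply/bigcupP; exists x; rewrite ?in_nbr.
  rewrite (negPf wD) /= in wB; case: (smallX0 x w _ exw wB wD).
  by rewrite in_setU (subsetP P0P).
- move=> x xP w exw wB; apply/orP; left.
  have [wD|wD] := boolP (D <= deg e w).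
    by rewrite in_setI inE wD; apply/bigcupP; exists x; rewrite ?in_nbr.
  rewrite (negPf wD) /= in wB; case: (smallX0 x w _ exw wB wD).
  by rewrite in_setU (subsetP Q0Q) ?orbT.
move=> f [f_inj fX fU favoid invf].
have fC x : f x \in C -> x \in XI.
  move=> fxC; apply: contraTT fxC => xI; have [xX|xX] := boolP (x \in X0).
    by rewrite fX //; apply/blkC/blk.
  exact/UC/fU.
exists f; split=> //.
  split=> [x i iL fx|i iV]; last by rewrite fX ?gXI // (subsetP XIX0) // imset_f.
  have := fC x; rewrite fx cC // => /(_ isT) xI; have xX := subsetP XIX0 _ xI.
  case/imsetP: xI fx xX => j jV -> + xX; rewrite fX // gXI // => /c_inj <-.
  by [].
move=> x y exy /fC xI fyC.
have yI : y \notin XI by apply: contra fyC => yI; rewrite fX ?XIC // (subsetP XIX0).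
have yX : y \in X0.
  rewrite !in_setU (negPf yI) /= !in_setD yI /=; apply/orP; left; apply/orP; left.
  by case/imsetP: xI exy => i iV -> exy; apply/bigcupP; exists i; rewrite ?in_nbr.
by rewrite fX //; apply: blk.
Qed.

(** * Induction over the trees *)

Section Trees.

Variables (Tr : forall i : 'I_t, rel 'I_(n - i)) (Vs : 'I_t -> {set 'I_t}) (prd : 'I_t -> 'I_t -> option 'I_t).
Arguments Tr : clear implicits.
Variable xi : forall i : 'I_t, 'I_t -> 'I_(n - i).
Hypothesis tr : forall i : 'I_t, is_tree (Tr i).
Hypotheses (L_deg : forall i, i \in L -> exists v, 80 * m <= deg (Tr i) v).
Hypotheses (notL_deg : forall i, i \notin L -> forall x, deg (Tr i) x <= 80 * m).
Hypotheses (Vs_L : forall j, Vs j \subset L) (Vs_lt : forall j i, i \in Vs j -> j < i).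
Hypothesis prd_Vs : forall j i p, prd j i = Some p -> [&& p < i, p \in Vs j & i \in Vs j].
Hypothesis prd_distinct : forall j j' i p, prd j i = Some p -> prd j' i = Some p -> j = j'.
Hypothesis xi_att : forall j, j \notin L -> attachment (Tr j) (Vs j) (prd j) (xi j).
Hypothesis card_Vs : forall j : 'I_t, j \notin L -> #|L| <= j + 1 + #|Vs j|.
Hypothesis cost : forall k, k \in L ->
  \sum_(j : 'I_t | (j < k) && (j \notin L)) (if k \in Vs j then deg (Tr j) (xi j k) - isSome (prd j k) else 0)
    <= #|[set j : 'I_t | (j < k) && (j \notin L)]| + 1.

Definition star_like (f : forall i : 'I_t, 'I_(n - i) -> V) (i : 'I_t) : Prop :=
  [/\ forall x y, Tr i x y -> f i x \in C -> f i x = c i \/ f i y = c i,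
      forall (l : 'I_t) x, l \in L -> l < i -> f i x <> c l &
      forall (j : 'I_t) x y z, j < i -> j \notin L -> Tr j x y -> f j x = c i -> f i z <> f j y].

Definition other_like (f : forall i : 'I_t, 'I_(n - i) -> V) (i : 'I_t) : Prop :=
  [/\ forall x l, l \in L -> f i x = c l -> l \in Vs i /\ x = xi i l,
      {in Vs i, forall l, f i (xi i l) = c l} &
      forall x y, Tr i x y -> f i x \in C -> f i y \notin C -> f i y \in Ba i :|: Bb i].

Definition disjoint_edges (f : forall i : 'I_t, 'I_(n - i) -> V) (i j : 'I_t) : Prop :=
  forall x y u v, Tr i x y -> Tr j u v -> f i x = f j u -> f i y = f j v -> False.

Definition packed_upto (k : nat) (f : forall i : 'I_t, 'I_(n - i) -> V) (H : rel V) : Prop :=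
  [/\ packing_inv k H, forall i : 'I_t, i < k -> injective (f i),
      forall (i : 'I_t) x y, i < k -> Tr i x y -> f i x \notin C -> f i y \notin C -> H (f i x) (f i y),
      forall i : 'I_t, i < k -> (i \in L -> star_like f i) /\ (i \notin L -> other_like f i) &
      forall i j : 'I_t, i < j -> j < k -> disjoint_edges f i j].

Lemma Tr_sym (i : 'I_t) : symmetric (Tr i).
Proof. by case: (tr i) => -[]. Qed.

Lemma Tr_irr (i : 'I_t) : irreflexive (Tr i).
Proof. by case: (tr i) => -[]. Qed.

(** If tree [i] is star-like, a shared edge ends at [c i], which tree [j] never uses. If only tree
    [j] is, the edge ends at [c j], and tree [j] avoids the hosts that tree [i] joined to it. If
    neither is, an edge leaving [C] ends in the blocks of both trees, and an edge inside [C] is a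
    chain step of both, against [prd_distinct]. *)
Lemma disjoint_in_C f (i j : 'I_t) x y u v : i < j ->
  (i \in L -> star_like f i) /\ (i \notin L -> other_like f i) ->
  (j \in L -> star_like f j) /\ (j \notin L -> other_like f j) ->
  Tr i x y -> Tr j u v -> f i x = f j u -> f i y = f j v -> f i x \in C -> False.
Proof.
move=> ij [iS iO] [jS jO] exy euv Ex Ey xC.
have [iL|iL] := boolP (i \in L); have [jL|jL] := boolP (j \in L).
- have [s1 _ _] := iS iL; have [_ s2 _] := jS jL.
  by case: (s1 x y exy xC); rewrite ?Ex ?Ey; apply: s2.
- have [s1 _ _] := iS iL; have [o1 _ _] := jO jL.
  by case: (s1 x y exy xC); rewrite ?Ex ?Ey => /(o1 _ _ iL)[/Vs_lt ji _]; rewrite ltnNge (ltnW ij) in ji.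
- have [s1 _ s3] := jS jL; have uC : f j u \in C by rewrite -Ex.
  case: (s1 u v euv uC); [rewrite -Ex | rewrite -Ey] => E.
    by apply: (s3 i x y v ij iL exy E); rewrite Ey.
  by rewrite Tr_sym in exy; apply: (s3 i y x u ij iL exy E); rewrite Ex.
- have [o1 _ o3] := iO iL; have [o1' _ o3'] := jO jL.
  have [yC|yC] := boolP (f i y \in C); last first.
    have uC : f j u \in C by rewrite -Ex.
    have := o3' u v euv uC; rewrite -Ey => /(_ yC) vB.
    by have E := B_inj (o3 x y exy xC yC) vB; rewrite E ltnn in ij.
  case/imsetP: xC => l lL El; case/imsetP: yC => p pL Ep.
  have [lV xE] := o1 x l lL El; have [pV yE] := o1 y p pL Ep.
  have [lV' uE] := o1' u l lL (etrans (esym Ex) El); have [pV' vE] := o1' v p pL (etrans (esym Ey) Ep).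
  have [_ a1 _ _] := xi_att iL; have [_ a2 _ _] := xi_att jL.
  rewrite xE yE in exy; rewrite uE vE in euv.
  have := a1 l p lV pV exy; have := a2 l p lV' pV' euv.
  have ne : i <> j by move=> E; rewrite E ltnn in ij.
  case=> e2 [] e1; try by apply: ne; apply: (prd_distinct e1 e2).
  + by have /and3P[h1 _ _] := prd_Vs e1; have /and3P[h2 _ _] := prd_Vs e2; rewrite ltnNge (ltnW h1) in h2.
  + by have /and3P[h1 _ _] := prd_Vs e1; have /and3P[h2 _ _] := prd_Vs e2; rewrite ltnNge (ltnW h1) in h2.
Qed.

Lemma packed_step (k : 'I_t) f H : packed_upto k f H -> exists f' H', packed_upto k.+1 f' H'.
Proof.
move=> [invH f_inj fH fT fD].
have extend (fk : 'I_(n - k) -> V) : injective fk -> (forall x y, Tr k x y -> ~~ H (fk x) (fk y)) ->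
    packing_inv k.+1 (add_edges (Tr k) fk H) ->
    (k \in L -> star_like (dfwith f fk) k) -> (k \notin L -> other_like (dfwith f fk) k) ->
    exists f' H', packed_upto k.+1 f' H'.
  move=> fk_inj fkH invH' fkS fkO; exists (dfwith f fk), (add_edges (Tr k) fk H).
  have old (i : 'I_t) : i < k -> dfwith f fk i = f i.
    by move=> ik; rewrite dfwith_out //; apply: contraTneq ik => ->; rewrite ltnn.
  have split_lt (i : 'I_t) : i < k.+1 -> i < k \/ i = k.
    by rewrite ltnS leq_eqVlt => /orP[/eqP/val_inj|]; [right | left].
  have oldT (i : 'I_t) : i < k ->
      (i \in L -> star_like (dfwith f fk) i) /\ (i \notin L -> other_like (dfwith f fk) i).
    move=> ik; have [hS hO] := fT i ik; split=> iL; last by rewrite /other_like old //; apply: hO.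
    have [s1 s2 s3] := hS iL; rewrite /star_like old //; split=> // j x y z ji jL.
    by rewrite old ?(ltn_trans ji) //; apply: s3.
  have allT (i : 'I_t) : i < k.+1 ->
      (i \in L -> star_like (dfwith f fk) i) /\ (i \notin L -> other_like (dfwith f fk) i).
    by move=> /split_lt[/oldT//|->].
  split=> //.
  - by move=> i /split_lt[ik|->]; [rewrite old //; apply: f_inj | rewrite dfwith_in].
  - move=> i x y /split_lt[ik|E].
      by rewrite old // => exy xC yC; rewrite /add_edges fH.
    subst i; rewrite dfwith_in => exy xC yC; rewrite /add_edges xC yC /=; apply/orP; right.
    by apply/existsP; exists x; apply/existsP; exists y; rewrite exy !eqxx.
  - move=> i j ij /split_lt[jk|E].
      by rewrite /disjoint_edges !old ?(ltn_trans ij) //; apply: fD.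
    move=> x y u v exy euv Ex Ey; subst j.
    have jT := allT k (ltnSn k); have iT := allT i (ltnW (ij : i < k)).
    have [xC|xC] := boolP (dfwith f fk i x \in C); first exact: (disjoint_in_C ij iT jT exy euv Ex Ey xC).
    have [yC|yC] := boolP (dfwith f fk i y \in C).
      by rewrite Tr_sym in exy; rewrite Tr_sym in euv; exact: (disjoint_in_C ij iT jT exy euv Ey Ex yC).
    have := fkH _ _ euv; move: Ex Ey xC yC; rewrite dfwith_in old // => <- <- xC yC.
    by rewrite fH.
have cT : #|'I_(n - k)| = n - k by rewrite card_ord.
have [kL|kL] := boolP (k \in L); last first.
  have [fk [fk_inj [o1 o2] o3 fkH invH']] :=
    embed_other (tr k) cT invH (xi_att kL) (Vs_L k) (card_Vs kL) (notL_deg kL).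
  apply: (extend fk) => //; first by rewrite (negPf kL).
  by move=> _; rewrite /other_like dfwith_in; split.
have [v vdeg] := L_deg kL.
pose Nb (j : 'I_t) := if k \in Vs j then f j @: nbr (Tr j) (xi j k) else set0.
pose low := c @: [set l in L | l < k].
(* A chain that continues to [c k] comes from an earlier centre, which [low] already counts; hence
   the subtraction of [isSome (prd j k)] in [cost]. *)
pose A := low :|: \bigcup_(j : 'I_t | (j < k) && (j \notin L)) Nb j.
have cNb (j : 'I_t) : j < k -> j \notin L ->
    #|Nb j :\: low| <= (if k \in Vs j then deg (Tr j) (xi j k) - isSome (prd j k) else 0).
  move=> jk jL; rewrite /Nb; case: ifP => kV; last by rewrite set0D cards0.
  have [_ hO] := fT j jk; have [o1 o2 _] := hO jL; have [_ _ a3 _] := xi_att jL.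
  case E: (prd j k) => [p|] /=; last first.
    by rewrite subn0; apply: leq_trans (subset_leq_card (subsetDl _ _)) (leq_imset_card _ _).
  have /and3P[pk pV _] := prd_Vs E.
  have cp : c p \in f j @: nbr (Tr j) (xi j k).
    by rewrite -(o2 p pV) imset_f // in_nbr a3.
  have cl : c p \in low by rewrite imset_f // inE pk (subsetP (Vs_L j)).
  apply: (@leq_trans #|(f j @: nbr (Tr j) (xi j k)) :\ c p|).
    by apply/subset_leq_card/subsetP => w; rewrite !in_setD in_set1 => /andP[wl ->];
      rewrite andbT; apply: contraNneq wl => ->.
  have := leq_imset_card (f j) (nbr (Tr j) (xi j k)); rewrite (cardsD1 (c p)) cp /deg; clear; lia.
have cA : #|A| <= k + 1.
  have sA : A \subset low :|: \bigcup_(j : 'I_t | (j < k) && (j \notin L)) (Nb j :\: low).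
    apply/subsetP => w /setUP[wl|/bigcupP[j jP wN]]; rewrite in_setU ?wl //.
    have [//|wl] := boolP (w \in low); apply/bigcupP; exists j => //; by rewrite in_setD wl.
  apply: leq_trans (subset_leq_card sA) _; apply: leq_trans (leq_card_setU _ _) _.
  have h1 : #|low| <= #|[set l in L | l < k]| by apply: leq_imset_card.
  have h2 : #|\bigcup_(j : 'I_t | (j < k) && (j \notin L)) (Nb j :\: low)| <=
      #|[set j : 'I_t | (j < k) && (j \notin L)]| + 1.
    apply: leq_trans (card_bigcup_leq _ _) _; apply: leq_trans (cost kL).
    by apply: leq_sum => j /andP[jk jL]; apply: cNb.
  have h3 : #|[set l in L | l < k]| + #|[set j : 'I_t | (j < k) && (j \notin L)]| <= k.
    rewrite -cardsUI (_ : _ :&: _ = set0) ?cards0 ?addn0; last first.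
      by apply/setP => l; rewrite !inE; case: (l \in L); rewrite ?andbF.
    by apply: card_lt_ord => l; rewrite !inE => /orP[/andP[]|/andP[]].
  move: h1 h2 h3; clear; lia.
have inA (j : 'I_t) x y : j < k -> j \notin L -> Tr j x y -> f j x = c k -> f j y \in A.
  move=> jk jL exy fx; have [_ hO] := fT j jk; have [o1 _ _] := hO jL.
  have [kV xE] := o1 x k kL fx; rewrite in_setU; apply/orP; right; apply/bigcupP; exists j; rewrite ?jk //.
  by rewrite /Nb kV imset_f // in_nbr -xE.
have ckA : c k \notin A.
  rewrite in_setU negb_or; apply/andP; split.
    by apply/imsetP => -[l + /c_inj E]; rewrite -E inE ltnn andbF.
  apply/bigcupP => -[j /andP[jk jL]]; rewrite /Nb; case: ifP => kV; last by rewrite inE.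
  have [_ hO] := fT j jk; have [_ o2 _] := hO jL.
  by case/imsetP=> y; rewrite in_nbr -(o2 k kV) => exy /(f_inj j jk) E; rewrite -E Tr_irr in exy.
have clA (l : 'I_t) : l \in L -> l < k -> c l \in A.
  by move=> lL lk; rewrite in_setU; apply/orP; left; apply: imset_f; rewrite inE lL.
have [fk [fk_inj fkA s1 fkH invH']] := embed_star (tr k) cT invH kL vdeg cA ckA clA.
apply: (extend fk) => //; last by rewrite kL.
move=> _; split; rewrite ?dfwith_in //.
- by move=> l x lL lk E; have := fkA x; rewrite E clA.
- move=> j x y z jk jL exy; have ne : k != j by apply: contraTneq jk => ->; rewrite ltnn.
  rewrite dfwith_out // => fx E; have := fkA z; by rewrite E (inA j x y).
Qed.

Lemma packing_inv0 : packing_inv 0 (fun _ _ => false).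
Proof.
have d0 v : deg (fun _ _ : V => false) v = 0 by apply: eq_card0 => w; rewrite in_nbr.
split=> //; first by rewrite big1.
  by move=> v; rewrite d0.
by split=> // u _; rewrite d0.
Qed.

Lemma packed_all : @packs_into_complete n.+1 _ (fun i : 'I_t => 'I_(n - i)) Tr.
Proof.
suff [f [H [_ f_inj _ _ fD]]] : exists f H, packed_upto t f H.
  exists f; split=> [i|i j x y u v ij exy euv]; first exact: f_inj.
  case: (ltngtP i j) => [lt|lt|/val_inj E]; last by rewrite E eqxx in ij.
  - case=> -[E1 E2]; first exact: (fD i j lt (ltn_ord j) x y u v exy euv E1 E2).
    by rewrite Tr_sym in euv; exact: (fD i j lt (ltn_ord j) x y v u exy euv E1 E2).
  - case=> -[E1 E2]; first exact: (fD j i lt (ltn_ord i) u v x y euv exy (esym E1) (esym E2)).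
    by rewrite Tr_sym in euv; exact: (fD j i lt (ltn_ord i) v u x y euv exy (esym E1) (esym E2)).
suff up k : k <= t -> exists f H, packed_upto k f H by exact: up.
elim: k => [_|k IH lt].
  by exists (fun i _ => c i), (fun _ _ => false); split=> //; exact: packing_inv0.
by have [f [H fH]] := IH (ltnW lt); apply: (@packed_step (Ordinal lt) f H).
Qed.

End Trees.

End Packing.

Lemma pack_large (Tr : forall i : 'I_t, rel 'I_(n - i)) : (forall i : 'I_t, is_tree (@Tr i)) ->
  @packs_into_complete n.+1 _ (fun i : 'I_t => 'I_(n - i)) Tr.
Proof.
move=> tr; have [c [Ba [Bb [c_inj cB B_inj AB [cBa cBb]]]]] := hosts_exist ineq_hosts.
have tm : 4 * t <= m by move: ineq_M M_lo; rewrite D_eq; clear; lia.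
have [L inL] : exists L : {set 'I_t}, forall i, (i \in L) = [exists v, 80 * m <= deg (@Tr i) v].
  by exists [set i : 'I_t | [exists v, 80 * m <= deg (@Tr i) v]] => i; rewrite inE.
have [P inP] : exists P : {set 'I_t}, forall i, (i \in P) = (i \notin L) && (#|[set x | deg (@Tr i) x == 1]| < t).
  by exists [set i : 'I_t | (i \notin L) && (#|[set x | deg (@Tr i) x == 1]| < t)] => i; rewrite inE.
have [vis [prd0 [s1 s2 s3 s4 [s5 s6]]]] := star_scheme L P.
(* A tree that is neither star-like nor path-like visits every later centre. *)
pose Vs (j : 'I_t) := [set i in L | (j < i) && ((j \in P) ==> vis j i)].
pose prd (j i : 'I_t) := if j \in P then prd0 j i else None.
have PL j : j \in P -> j \notin L by rewrite inP => /andP[].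
have [xi xiP] : exists xi : forall i : 'I_t, 'I_t -> 'I_(n - i), forall j, j \notin L ->
    attachment (@Tr j) (Vs j) (prd j) (xi j) /\ forall i, deg (@Tr j) (xi j i) <= 1 + (j \in P).
  apply: (@fin_all_exists _ (fun j : 'I_t => 'I_t -> 'I_(n - j)) (fun j xi => j \notin L ->
    attachment (@Tr j) (Vs j) (prd j) xi /\ forall i, deg (@Tr j) (xi i) <= 1 + (j \in P))) => j.
  have tj := ltn_ord j; have big : m <= n - j by move: tj tm n_lo m_lo; clear; lia.
  have [jL|jL] := boolP (j \in L).
    by have [_ /card_gt0P[x _] _ _] := tr j; exists (fun _ => x).
  have [jP|jP] := boolP (j \in P).
    have := jP; rewrite inP => /andP[_ /ltnW few].
    have [||i p|i i' p|xi att] := @attachment_few_leaves t _ (@Tr j) (Vs j) (prd j) (tr j) few.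
    - by rewrite card_ord; move: ineq_bare tj tm n_lo m_lo; clear; lia.
    - by rewrite card_ord; move: big m_lo; clear; lia.
    - by rewrite /prd jP => /s1/and3P[].
    - by rewrite /prd jP; apply: s2.
    by exists xi => _; split=> // i; have [_ _ _] := att.
  have := jP; rewrite inP jL /= -leqNgt => many; have [[e_sym e_irr] _ conn _] := tr j.
  have [|xi att xi1] := @attachment_leaves t _ (@Tr j) (Vs j) e_sym e_irr conn _ many.
    by rewrite card_ord; move: big m_lo; clear; lia.
  exists xi => _; split=> [|i]; last by rewrite xi1.
  have [a1 a2 a3 a4] := att; split=> //; first by move=> i i' iV iV' /(a2 _ _ iV iV')[].
  by move=> i p; rewrite /prd (negPf jP).
have lt_disj (A A' : {set 'I_t}) (k : nat) : [disjoint A & A'] ->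
    #|[set l in A | l < k]| + #|[set l in A' | l < k]| <= k.
  move=> dA; rewrite -cardsUI (_ : _ :&: _ = set0) ?cards0 ?addn0; last first.
    apply/setP => l; rewrite !inE; apply/negP => /andP[/andP[lA _] /andP[lA' _]].
    by have := disjointFr dA lA; rewrite lA'.
  by apply: card_lt_ord => l; rewrite !inE => /orP[] /andP[].
apply: (packed_all (L := L) c_inj cB B_inj AB cBa cBb (Tr := Tr) (Vs := Vs) (prd := prd) (xi := xi) tr).
- by move=> i; rewrite inL => /existsP.
- by move=> i; rewrite inL => /existsPn h x; apply: ltnW; rewrite ltnNge.
- by move=> j; apply/subsetP => i; rewrite inE => /andP[].
- by move=> j i; rewrite inE => /and3P[].
- move=> j i p; rewrite /prd; case: ifP => // jP /s1/and3P[-> vp vi].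
  have /and3P[pL _ jp] := s6 _ _ vp; have /and3P[iL _ ji] := s6 _ _ vi.
  by rewrite !inE pL jp iL ji vp vi !implybT.
- by move=> j j' i p; rewrite /prd; case: ifP => // _; case: ifP => // _; apply: s3.
- by move=> j jL; have [] := xiP j jL.
- move=> j jL.
  (* The skipped centres are at most as many as the smaller path-like trees, which are disjoint from
     the smaller star-like ones; so at most [j] centres are not visited. *)
  have sub : L \subset [set l in L | l < j] :|: (Vs j :|: [set i in L | (j < i) && (j \in P) && ~~ vis j i]).
    apply/subsetP => l lL; rewrite !inE lL /=; case: (ltngtP l j) => //= [_|/val_inj E].
      by case: (j \in P) => //=; rewrite orbN.
    by rewrite -E lL in jL.
  apply: leq_trans (subset_leq_card sub) _; apply: leq_trans (leq_card_setU _ _) _.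
  have c1 : #|Vs j :|: [set i in L | (j < i) && (j \in P) && ~~ vis j i]| <=
      #|Vs j| + #|[set i in L | (j < i) && (j \in P) && ~~ vis j i]| := leq_card_setU _ _.
  have c2 : #|[set i in L | (j < i) && (j \in P) && ~~ vis j i]| <= #|[set l in P | l < j]|.
    have [jP|jP] := boolP (j \in P); last first.
      by rewrite (_ : [set i in L | _] = set0) ?cards0 //; apply/setP => i; rewrite !inE !andbF.
    apply: leq_trans (s5 j jP); apply/subset_leq_card/subsetP => i; rewrite !inE.
    by rewrite andbT.
  have c3 := @lt_disj L P j.
  have dLP : [disjoint L & P] by rewrite disjoints_subset; apply/subsetP => l lL; rewrite inE inP lL.
  move: c1 c2 (c3 dLP); clear; lia.
- move=> k kL; pose W := [set j : 'I_t | (j < k) && (j \notin L)].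
  have -> : \sum_(j : 'I_t | (j < k) && (j \notin L))
      (if k \in Vs j then deg (@Tr j) (xi j k) - isSome (prd j k) else 0) =
    \sum_(j in W) (if k \in Vs j then deg (@Tr j) (xi j k) - isSome (prd j k) else 0).
    by apply: eq_bigl => j; rewrite inE.
  rewrite -/W; have h := s4 k kL.
  have skip : #|[set j in P | (j < k) && ~~ vis j k]| = \sum_(j in W) ((j \in P) && ~~ vis j k).
    rewrite -sum1_card big_mkcond [RHS]big_mkcond; apply: eq_bigr => j _; rewrite !inE.
    have [/PL->|_] := boolP (j \in P); rewrite ?andbF ?andbT //=; by case: (j < k); case: (vis j k); rewrite ?if_same.
  have opn : #|[set j in P | [&& j < k, vis j k & prd0 j k == None]]| =
      \sum_(j in W) [&& j \in P, vis j k & prd0 j k == None].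
    rewrite -sum1_card big_mkcond [RHS]big_mkcond; apply: eq_bigr => j _; rewrite !inE.
    have [/PL->|_] := boolP (j \in P); rewrite ?andbF ?andbT //=;
      by case: (j < k); case: (vis j k); case: (prd0 j k); rewrite ?if_same.
  (* Termwise, a leaf or a continued chain contributes at most 1 to the first sum, an opening at
     most 2 and a skip 0, while a skip contributes 1 to the second sum. *)
  have main : \sum_(j in W) (if k \in Vs j then deg (@Tr j) (xi j k) - isSome (prd j k) else 0) +
      \sum_(j in W) ((j \in P) && ~~ vis j k) <= #|W| + \sum_(j in W) [&& j \in P, vis j k & prd0 j k == None].
    rewrite -big_split -sum1_card -big_split; apply: leq_sum => j; rewrite inE => /andP[jk jL] /=.
    have [_ d1] := xiP j jL; have := d1 k; rewrite [k \in Vs j]inE kL jk /prd /=.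
    case: (j \in P) => /=; last by rewrite addn0; lia.
    by case: (vis j k) => //=; case: (prd0 j k) => [p|] /=; lia.
  by move: main h; rewrite skip opn; clear; lia.
Qed.

End Assembly.

(** With [s], [b], [sS] and [bB] linear in [t], the heaviest demands are the [t * (2 * b)] reserved
    hosts times their degree [D * t], and the bare paths; both are cubic in [t]. *)
Lemma pack_cubic : exists K : nat, 0 < K /\ forall n t : nat, 0 < t -> K * (t * t * t) <= n %/ 100 ->
  forall Tr : (forall i : 'I_t, rel 'I_(n - i)), (forall i : 'I_t, is_tree (@Tr i)) ->
  @packs_into_complete n.+1 _ (fun i : 'I_t => 'I_(n - i)) Tr.
Proof.
(* [D] stays abstract so that [K] is never computed as a huge unary number. *)
have [D D_eq] : exists D, D = 40 by exists 40.
pose r := 1 + D + D * D.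
pose s0 := r * (6 * D * D) + 1; pose b0 := 2 + D * s0.
pose K := 1000 + 80 * (D + 1) + r * (6 * D * D + 12 * D * D + 2 * b0) + 2 * (D * (2 * b0 * (1 + D)))
  + 2 * b0 * (1 + D) + D * (4 + 2 * D * s0) + s0 + 3 + 3 * D + 20.
exists K; split; first by rewrite /K; clear; lia.
move=> n t t0 le Tr tr.
pose m := n %/ 100; pose M := m %/ 80.
have [T1 T2] : t <= t * t * t /\ t * t <= t * t * t.
  by split; [apply: leq_trans (leq_pmulr _ t0) _; rewrite -mulnA leq_mul2l leq_pmulr ?orbT | apply: leq_pmulr].
have T0 : 1 <= t * t * t by apply: leq_trans T1.
have A0 a : a <= a * (t * t * t) by rewrite leq_pmulr.
have A1 a : a * t <= a * (t * t * t) by rewrite leq_mul2l T1 orbT.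
have A2 a : a * (t * t) <= a * (t * t * t) by rewrite leq_mul2l T2 orbT.
have le' : K * (t * t * t) <= m by [].
have n_lo : 100 * m <= n by rewrite /m; clear; lia.
have n_hi : n < 100 * m + 100 by rewrite /m; clear; lia.
have M_lo : 80 * M <= m by rewrite /M; clear; lia.
have M_hi : m < 80 * M + 80 by rewrite /M; clear; lia.
have part a : a <= K -> a * (t * t * t) <= m.
  by move=> aK; apply: leq_trans le'; rewrite leq_mul2r aK orbT.
have m_lo : 1000 <= m by apply: leq_trans (A0 _) (part 1000 _); rewrite /K; clear; lia.
clearbody m M.
have pM : 80 * (D * t) + 80 <= m.
  have /part h : 80 * (D + 1) <= K by rewrite /K; clear; lia.
  by apply: leq_trans h; have := A1 (80 * D); have := A0 80; clear; lia.
(* As [2 n <= 202 m], the factor [6 * D * D] is chosen above [202 * D], and [12 * D * D = 240 * 80]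
   is large enough because [202 m <= 240 * (80 M)]. *)
apply: (@pack_large n t m M (b0 * t) (s0 * t) (6 * D * D * t) (12 * D * D * t) D) => //.
- by move: pM M_hi; clear; lia.
- have h : 2 * n * (D * t) <= 2 * (101 * m) * (D * t).
    by rewrite leq_mul2r leq_mul2l; apply/orP; right; apply/orP; right; move: n_hi m_lo; clear; lia.
  apply: leq_ltn_trans h _; rewrite D_eq mulSn; move: m_lo; clear; nia.
- have h : 2 * n * t <= 202 * m * t.
    by rewrite leq_mul2r; apply/orP; right; move: n_hi m_lo; clear; lia.
  have h2 : 202 * m * t <= 240 * (80 * M) * t.
    by rewrite leq_mul2r; apply/orP; right; move: M_hi m_lo; clear; lia.
  have Mpos : 0 < M by move: M_hi m_lo; clear; lia.
  by apply: leq_ltn_trans (leq_trans h h2) _; rewrite D_eq mulSn; move: Mpos; clear; nia.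
- by rewrite /s0 -/r mulnDl mul1n -[X in X < _]addn0 -!mulnA ltn_add2l.
- by rewrite /b0 mulnDl mulnA.
- rewrite -/r; set a := 6 * D * D + 12 * D * D + 2 * b0.
  have /part h : r * a <= K by rewrite /K -/a; clear; lia.
  apply: leq_trans h; rewrite -[r * a * _]mulnA leq_mul2l; apply/orP; right.
  by rewrite /a; have := A1 (6 * D * D); have := A1 (12 * D * D); have := A2 (2 * b0); clear; lia.
- have /part h : 2 * b0 * (1 + D) <= K by rewrite /K; clear; lia.
  by apply: leq_trans h; have := A2 (2 * b0); have := A0 1; clear; nia.
- have /part h : 2 * (D * (2 * b0 * (1 + D))) <= K by rewrite /K; clear; lia.
  apply: leq_trans h; have h1 : t * (2 * (b0 * t)) * (1 + D * t) <= 2 * b0 * (1 + D) * (t * t * t).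
    by have := A2 (2 * b0); clear; lia.
  by rewrite -(mulnA 2 (D * _)) -(mulnA D) !leq_mul2l h1 !orbT.
- have /part h : D * (4 + 2 * D * s0) <= K by rewrite /K; clear; lia.
  by apply: leq_trans h; have := A1 D; have := A2 (3 * D); have := A2 (2 * D * D * s0); clear; lia.
- have /part h : s0 + 3 + 3 * D <= K by rewrite /K; clear; lia.
  by apply: leq_trans h; have := A1 (s0 + 3 + 3 * D); clear; lia.
- have /part h : 2 * b0 + 1 <= K by rewrite /K; clear; nia.
  apply: (@leq_trans m); [apply: leq_trans h; have := A2 (2 * b0); have := A1 1; clear; lia |].
  by move: n_lo; clear; lia.
- have /part h : 14 <= K by rewrite /K; clear; lia.
  by apply: leq_trans h; have := A1 2; have := A2 8; clear; lia.
Qed.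

Lemma tnum_spec n : (10 * tnum n) ^ 4 <= n.
Proof.
rewrite /tnum; elim/big_ind: _ => // x y hx hy.
by rewrite /maxn; case: ifP.
Qed.

Theorem theorem5 :
  exists n0 : nat, forall n : nat, n0 <= n ->
    forall T : forall i : 'I_(tnum n), rel 'I_(n - i),
      (forall i : 'I_(tnum n), is_tree (T i)) ->
      @packs_into_complete n.+1 _ (fun i : 'I_(tnum n) => 'I_(n - i)) T.
Proof.
(* From this [n0] on, [t >= K]. One of the four factors [t] in [(10 t)^4 <= n] then pays for [K],
   and the factor [10^4] for the division by 100. *)
have [K [K0 pack]] := pack_cubic; exists ((10 * K) ^ 4) => n hn T hT.
have Kt : K <= tnum n.
  have Kn : K < n.+1.
    rewrite ltnS; apply: leq_trans hn; apply: leq_trans (leq_pmull K (_ : 0 < 10)) _ => //.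
    by rewrite -{1}[10 * K]expn1 leq_pexp2l // muln_gt0.
  exact: (@leq_bigmax_cond _ (fun k : 'I_n.+1 => (10 * k) ^ 4 <= n) (fun k => k) (Ordinal Kn) hn).
have := tnum_spec n; move: (tnum n) T hT Kt => t T hT Kt tn.
apply: pack => //; first exact: leq_trans K0 Kt.
rewrite leq_divRL //; apply: leq_trans tn.
have -> : (10 * t) ^ 4 = t * (t * t * t) * 100 * 100 by rewrite !expnS expn0; lia.
by apply: leq_trans (leq_pmulr _ _) => //; rewrite !leq_mul2r Kt !orbT.
Qed.
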